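(* Let $E$ be a Banach space with a normalized $1$-unconditional basis $(e_n)_{n=1}^\infty$ and assume $\mathrm{Sz}(E)=\omega$. Then for any sequence $(F_n)_{n=1}^\infty$ of finite-dimensional Banach spaces we have $$\mathsf{p}\Bigl(\Bigl(\bigoplus_{n=1}^\infty F_n\Bigr)_{E}\Bigr)=\mathsf{p}(E).$$
   Context: For a Banach space $X$, $B_X$ denotes its unit ball. For a weak$^\ast$-compact set $K\subset X^\ast$ and $\varepsilon>0$, the $\varepsilon$-Szlenk derivation is $$\iota_\varepsilon K=\{x^\ast\in K:\ \mathrm{diam}(K\cap U)>\varepsilon\text{ for every }w^\ast\text{-open neighborhood }U\text{ of }x^\ast\},$$ with iterates $\iota^0_\varepsilon K=K$, $\iota_\varepsilon^{\alpha+1}K=\iota_\varepsilon(\iota_\varepsilon^\alpha K)$, and $\iota_\varepsilon^\alpha K=\bigcap_{\beta<\alpha}\iota_\varepsilon^\beta K$ for limit $\alpha$. $\mathrm{Sz}(X,\varepsilon)$ is the least ordinal $\alpha$ (if any) with $\iota_\varepsilon^\alpha B_{X^\ast}=\varnothing$, and $\mathrm{Sz}(X)=\sup_{\varepsilon>0}\mathrm{Sz}(X,\varepsilon)$. The condition $\mathrm{Sz}(X)\leq\omega$ is equivalent to $\mathrm{Sz}(X,\varepsilon)$ being finite for every $\varepsilon>0$. For $\mathrm{Sz}(X)\le\omega$ the following finite limit, called the Szlenk power type of $X$, exists: $$\mathsf{p}(X)=\lim_{\varepsilon\to0+}\frac{\log\mathrm{Sz}(X,\varepsilon)}{|\log\varepsilon|}.$$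 The space $(\bigoplus_{n=1}^\infty F_n)_E$ consists of all sequences $(x_n)$ with $x_n\in F_n$ for which $\sum_n\|x_n\|e_n$ converges in $E$, with norm $\|\sum_n\|x_n\|e_n\|_E$.
   Formalization: The finite-dimensional spaces F_n are assumed to be nonzero; if all F_n are zero the direct sum is the zero space, with power type 0, whereas for example p(c_0)=1, so the claim fails without this assumption. *)

(* Defs.v *)
From HB Require Import structures.
From mathcomp Require Import all_boot all_order all_algebra.
From mathcomp Require Import complex.
From mathcomp Require Import all_classical all_reals all_analysis.
Import Order.TTheory GRing.Theory Num.Theory.
Import numFieldNormedType.Exports.

Set Implicit Arguments.
Unset Strict Implicit.
Unset Printing Implicit Defensive.

Local Open Scope classical_set_scope.
Local Open Scope ring_scope.

(* Banach spaces are real or complex. The norm of a complex normed module is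
   valued in R[i], with zero imaginary part; [real_part] brings it to R. *)
Variant scalar_kind := RealScalars | ComplexScalars.

Definition scalar_field (R : realType) (k : scalar_kind) : numFieldType :=
  match k with
  | RealScalars => R
  | ComplexScalars => R[i]
  end.

Definition real_part (R : realType) (k : scalar_kind) :
    scalar_field R k -> R :=
  match k with
  | RealScalars => fun x : R => x
  | ComplexScalars => fun z : R[i] => complex.Re z
  end.

(* Ordinals, as arbitrarily branching trees up to the equivalence
   [ord_le a b /\ ord_le b a]. Limit ordinals are suprema, and [OrdSup] allows
   any family of ordinals. *)
Inductive ordinal_tree : Type :=
  | OrdZero
  | OrdSucc of ordinal_tree
  | OrdSup (I : Type) of (I -> ordinal_tree).

Inductive ord_le : ordinal_tree -> ordinal_tree -> Prop :=
  | OrdLeZero b : ord_le OrdZero b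
  | OrdLeSucc a b : ord_le a b -> ord_le (OrdSucc a) (OrdSucc b)
  | OrdLeSup a (I : Type) (f : I -> ordinal_tree) (i : I) :
      ord_le a (f i) -> ord_le a (OrdSup f)
  | OrdSupLe (I : Type) (f : I -> ordinal_tree) b :
      (forall i, ord_le (f i) b) -> ord_le (OrdSup f) b.

Fixpoint ord_nat (n : nat) : ordinal_tree :=
  if n is m.+1 then OrdSucc (ord_nat m) else OrdZero.

Definition ord_omega : ordinal_tree := OrdSup ord_nat.

Section Dual.
Variables (K : numFieldType) (E : normedModType K).

Record dual_space := DualSpace {
  dual_fun :> E -> K ;
  dual_linear : linear (dual_fun : E -> K^o) ;
  dual_continuous : continuous dual_fun }.

HB.instance Definition _ := gen_eqMixin dual_space.
HB.instance Definition _ := gen_choiceMixin dual_space.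

(* The topology of [dual_space] is the weak-star one. *)
HB.instance Definition _ := Topological.copy dual_space
  (initial_topology (fun f : dual_space => (f : {ptws E -> K}))).

End Dual.

Section Szlenk.
Variables (R : realType) (k : scalar_kind).
Local Notation K := (scalar_field R k).
Variable X : normedModType K.

Definition op_norm (f : X -> K) : \bar R :=
  ereal_sup [set (real_part `|f x|)%:E | x in [set x : X | `|x| <= 1]].

Definition dual_ball : set (dual_space X) := [set f | (op_norm f <= 1)%E].

Definition dual_diam (A : set (dual_space X)) : \bar R :=
  ereal_sup [set op_norm (fun x => f x - g x) | f in A & g in A].

Definition szlenk_derivation (eps : R) (A : set (dual_space X)) :
    set (dual_space X) :=
  [set f | A f /\
    forall U, open_nbhs f U -> (eps%:E < dual_diam (A `&` U))%E].

(* At [OrdSup g] the intersection over the [g i] agrees with the one over all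
   smaller ordinals since the derivations decrease; the set [A] is there for
   the empty supremum. *)
Fixpoint szlenk_iter (eps : R) (alpha : ordinal_tree)
    (A : set (dual_space X)) : set (dual_space X) :=
  match alpha with
  | OrdZero => A
  | OrdSucc b => szlenk_derivation eps (szlenk_iter eps b A)
  | OrdSup J g => A `&` \bigcap_(i in [set: J]) szlenk_iter eps (g i) A
  end.

(* Sz(X, eps) exists and is alpha *)
Definition is_szlenk_eps (eps : R) (alpha : ordinal_tree) : Prop :=
  szlenk_iter eps alpha dual_ball = set0 /\
  forall beta, szlenk_iter eps beta dual_ball = set0 -> ord_le alpha beta.

(* Sz(X) exists and is alpha *)
Definition is_szlenk (alpha : ordinal_tree) : Prop :=
  (forall eps : R, 0 < eps ->
     exists2 b, is_szlenk_eps eps b & ord_le b alpha) /\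
  (forall gamma,
     (forall (eps : R) b, 0 < eps -> is_szlenk_eps eps b -> ord_le b gamma) ->
     ord_le alpha gamma).

(* the number Sz(X, eps) when it is finite; 0 otherwise *)
Definition szlenk_nat (eps : R) : nat :=
  xget 0%N [set n | is_szlenk_eps eps (ord_nat n)].

(* p(X) is defined and is p *)
Definition is_szlenk_power_type (p : R) : Prop :=
  (exists2 alpha, is_szlenk alpha & ord_le alpha ord_omega) /\
  (ln (szlenk_nat eps)%:R / `|ln eps|) @[eps --> 0^'+] --> p.

End Szlenk.

Section Basis.
Variables (K : numFieldType) (E : normedModType K).

Definition schauder_basis (e : nat -> E) : Prop :=
  forall x : E, exists! a : nat -> K, series (fun n => a n *: e n) @ \oo --> x.

Definition one_unconditional (e : nat -> E) : Prop :=
  forall (N : nat) (a b : nat -> K),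
    (forall n, (n < N)%N -> `|a n| <= `|b n|) ->
    `|\sum_(n < N) a n *: e n| <= `|\sum_(n < N) b n *: e n|.

Definition normalized_1unconditional_basis (e : nat -> E) : Prop :=
  [/\ schauder_basis e, one_unconditional e & forall n, `|e n| = 1].

Definition finite_dimensional : Prop :=
  exists (m : nat) (b : 'I_m -> E),
    forall x, exists c : 'I_m -> K, x = \sum_(i < m) c i *: b i.

End Basis.

Section UnconditionalSeries.
Variables (K : numFieldType) (E : completeNormedModType K) (e : nat -> E).
Hypothesis he : normalized_1unconditional_basis e.

Lemma dominated_sum (a b : nat -> K) (m n : nat) :
  (forall i, `|a i| <= `|b i|) ->
  `|\sum_(m <= i < n) a i *: e i| <= `|\sum_(m <= i < n) b i *: e i|.
Proof.
move=> ab; have [_ unc _] := he.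
have E0 (c : nat -> K) : \sum_(m <= i < n) c i *: e i =
    \sum_(i < n) (if (m <= i)%N then c i else 0) *: e i.
  rewrite -(big_mkord xpredT (fun i => (if (m <= i)%N then c i else 0) *: e i)).
  rewrite (big_nat_widenl m 0)// big_mkcond/=.
  by apply: eq_bigr => i _; case: ifP => //; rewrite scale0r.
rewrite !E0; pose cut (c : nat -> K) i := if (m <= i)%N then c i else 0.
by apply: (unc n (cut a) (cut b)) => i _; rewrite /cut; case: ifP.
Qed.

Lemma dominated_cvg (a b : nat -> K) :
  (forall i, `|a i| <= `|b i|) ->
  cvgn (series (fun n => b n *: e n)) -> cvgn (series (fun n => a n *: e n)).
Proof.
move=> ab /cauchy_cvgP/cauchy_seriesP hb.
apply/cauchy_cvgP/cauchy_seriesP => eps /hb.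
by apply: filterS => n; apply: le_lt_trans; exact: dominated_sum.
Qed.

Lemma dominated_lim (a b : nat -> K) :
  (forall i, `|a i| <= `|b i|) ->
  cvgn (series (fun n => b n *: e n)) ->
  `|limn (series (fun n => a n *: e n))| <=
  `|limn (series (fun n => b n *: e n))|.
Proof.
move=> ab cb; have ca := dominated_cvg ab cb.
apply/ler_addgt0Pr => eps eps0.
have e2 : 0 < eps / 2 by rewrite divr_gt0.
have /cvgrPdist_lt/(_ _ e2) ha := ca.
have /cvgrPdist_lt/(_ _ e2) hb := cb.
near \oo => n.
have /ltW han : `|limn (series (fun n => a n *: e n))
  - series (fun n => a n *: e n) n| < eps / 2 by near: n; exact: ha.
have /ltW hbn : `|limn (series (fun n => b n *: e n))
  - series (fun n => b n *: e n) n| < eps / 2 by near: n; exact: hb.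
set la := limn _ in han *; set lb := limn _ in hbn *.
rewrite -(subrK (series (fun n => a n *: e n) n) la).
apply: (le_trans (ler_normD _ _)).
rewrite [eps]splitr addrCA; apply: lerD => //.
apply: (le_trans (dominated_sum 0 n ab)).
rewrite -/(series (fun n => b n *: e n) n) -lerBlDl.
by apply: le_trans hbn; rewrite distrC lerB_dist.
Unshelve. all: by end_near. Qed.

End UnconditionalSeries.

Section DirectSum.
Variables (K : numFieldType) (E : completeNormedModType K) (e : nat -> E).
Variable F : nat -> completeNormedModType K.

Record dsum_carrier := DSum {
  dsum_coord :> forall n, F n ;
  dsum_cvg : cvgn (series (fun n => `|dsum_coord n| *: e n)) }.

(* The algebraic operations and the norm need [he] to be well defined, hence
   the parameter. *)
Definition direct_sum (he : normalized_1unconditional_basis e) := dsum_carrier.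

Variable he : normalized_1unconditional_basis e.
Local Notation X := (direct_sum he).

HB.instance Definition _ := gen_eqMixin X.
HB.instance Definition _ := gen_choiceMixin X.

Lemma dsumP (x y : X) : (forall n, x n = y n) -> x = y.
Proof.
case: x y => [x hx] [y hy] /= xy.
have {}xy : x = y by exact: functional_extensionality_dep.
by rewrite xy in hx *; congr DSum; exact: Prop_irrelevance.
Qed.

Lemma dsum0_cvg : cvgn (series (fun n => `|0 : F n| *: e n)).
Proof.
rewrite (_ : series _ = fun=> 0); first exact: is_cvg_cst.
by apply/funext => n; rewrite /series/= big1// => i _; rewrite normr0 scale0r.
Qed.

Lemma dsumB_cvg (x y : X) : cvgn (series (fun n => (`|x n| + `|y n|) *: e n)).
Proof.
rewrite (_ : series _ = series (fun n => `|x n| *: e n) +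
    series (fun n => `|y n| *: e n)); last first.
  rewrite -seriesD; congr series; apply/funext => n.
  by rewrite scalerDl.
by apply: is_cvgD; exact: dsum_cvg.
Qed.

Lemma dsumD_cvg (x y : X) : cvgn (series (fun n => `|x n + y n| *: e n)).
Proof.
apply: (dominated_cvg he (b := fun n => `|x n| + `|y n|)) => [i|];
  last exact: dsumB_cvg.
by rewrite normr_id ger0_norm ?addr_ge0// ler_normD.
Qed.

Lemma dsumZ_cvg (c : K) (x : X) : cvgn (series (fun n => `|c *: x n| *: e n)).
Proof.
rewrite (_ : (fun n => _) = `|c| *: (fun n => `|x n| *: e n)).
  by rewrite seriesZ; apply: is_cvgZl_tmp; exact: dsum_cvg.
by apply/funext => n; rewrite normrZ -scalerA.
Qed.

Lemma dsumN_cvg (x : X) : cvgn (series (fun n => `|- x n| *: e n)).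
Proof.
by under eq_fun do rewrite normrN; exact: dsum_cvg.
Qed.

Definition dsum_zero : X := DSum dsum0_cvg.
Definition dsum_add (x y : X) : X := DSum (@dsumD_cvg x y).
Definition dsum_opp (x : X) : X := DSum (@dsumN_cvg x).
Definition dsum_scale (c : K) (x : X) : X := DSum (@dsumZ_cvg c x).

Lemma dsum_addA : associative dsum_add.
Proof. by move=> x y z; apply: dsumP => n; exact: addrA. Qed.

Lemma dsum_addC : commutative dsum_add.
Proof. by move=> x y; apply: dsumP => n; exact: addrC. Qed.

Lemma dsum_add0 : left_id dsum_zero dsum_add.
Proof. by move=> x; apply: dsumP => n; exact: add0r. Qed.

Lemma dsum_addN : left_inverse dsum_zero dsum_opp dsum_add.
Proof. by move=> x; apply: dsumP => n; exact: addNr. Qed.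

HB.instance Definition _ := GRing.isZmodule.Build X
  dsum_addA dsum_addC dsum_add0 dsum_addN.

Lemma dsum_scaleA (a b : K) (x : X) :
  dsum_scale a (dsum_scale b x) = dsum_scale (a * b) x.
Proof. by apply: dsumP => n; exact: scalerA. Qed.

Lemma dsum_scale1 : left_id 1 dsum_scale.
Proof. by move=> x; apply: dsumP => n; exact: scale1r. Qed.

Lemma dsum_scaleDr : right_distributive dsum_scale +%R.
Proof. by move=> c x y; apply: dsumP => n; exact: scalerDr. Qed.

Lemma dsum_scaleDl (x : X) : {morph dsum_scale^~ x : a b / a + b}.
Proof. by move=> a b; apply: dsumP => n; exact: scalerDl. Qed.

HB.instance Definition _ := GRing.Zmodule_isLmodule.Build K X
  dsum_scaleA dsum_scale1 dsum_scaleDr dsum_scaleDl.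

Definition dsum_norm (x : X) : K := `|limn (series (fun n => `|x n| *: e n))|.

Lemma dsum_normD (x y : X) : dsum_norm (x + y) <= dsum_norm x + dsum_norm y.
Proof.
rewrite /dsum_norm; apply: le_trans (ler_normD _ _).
rewrite -limD; [rewrite -seriesD|exact: dsum_cvg..].
rewrite (_ : _ + _ = fun n => (`|x n| + `|y n|) *: e n); last first.
  by apply/funext => n; rewrite scalerDl.
apply: (dominated_lim he (b := fun n => `|x n| + `|y n|)) => [i|];
  last exact: dsumB_cvg.
by rewrite normr_id ger0_norm ?addr_ge0// ler_normD.
Qed.

Lemma dsum_normZ (c : K) (x : X) : dsum_norm (c *: x) = `|c| * dsum_norm x.
Proof.
rewrite /dsum_norm (_ : (fun n => _) = `|c| *: (fun n => `|x n| *: e n)).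
  by rewrite seriesZ limZl_tmp ?normrZ ?normr_id//; exact: dsum_cvg.
by apply/funext => n; rewrite normrZ -scalerA.
Qed.

Lemma dsum_norm_eq0 (x : X) : dsum_norm x = 0 -> x = 0.
Proof.
move=> /normr0_eq0 x0; have [basis _ _] := he.
have [a [_ uniq]] := basis 0.
have cx : series (fun n => `|x n| *: e n) @ \oo --> (0 : E).
  by rewrite -x0; exact: dsum_cvg.
have c0 : series (fun n => 0 *: e n) @ \oo --> (0 : E).
  rewrite (_ : series _ = fun=> 0); first exact: cvg_cst.
  by apply/funext => n; rewrite /series/= big1// => i _; rewrite scale0r.
apply: dsumP => n; apply: normr0_eq0.
have := uniq _ c0; rewrite (uniq (fun n => `|x n|) cx) => h.
by have := congr1 (@^~ n) h.
Qed.

HB.instance Definition _ := Lmodule_isNormed.Build K X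
  dsum_normD dsum_normZ dsum_norm_eq0.

End DirectSum.

(* Main.v *)
(* Write X for the direct sum and S for the Szlenk number Sz(-, eps). Rescaling
   a piece of diameter at most eps into the unit ball gives
   S(eps * del) <= S(eps) * S(del), so p(E) exists by Fekete's lemma, and S may
   be replaced by S(c * -) or changed by bounded factors without affecting p.
   If phi_n in the unit ball of F_n^* takes the value 1/2 at u_n in the unit
   ball of F_n, the adjoint of (x_n) |-> sum_n phi_n(x_n) e_n embeds E^* into
   X^* and shows that S_E(eps) <= S_X(eps / 2).
   Conversely, (f_n) |-> (||f_n|| / 2) maps the ball of X^* to that of E^*. It
   is weak-star continuous since the F_n are finite dimensional; since Sz(E) is
   omega, the basis is shrinking, so that a functional f whose modulus is close
   in norm to that of f0 and whose first components are close to those of f0 is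
   close in norm to f0. Hence the derivations of parameter 16 * del in X^* are
   mapped into those of parameter del in E^*, and S_X(16 * del) <= S_E(del). *)
Require Import Defs.
From HB Require Import structures.
From mathcomp Require Import all_boot all_order all_algebra.
From mathcomp Require Import complex.
From mathcomp Require Import all_classical all_reals all_analysis.
From mathcomp Require Import ring lra.
Import Order.TTheory GRing.Theory Num.Theory.
Import numFieldNormedType.Exports.

Set Implicit Arguments.
Unset Strict Implicit.
Unset Printing Implicit Defensive.

Local Open Scope classical_set_scope.
Local Open Scope ring_scope.

(** Neither weak-star compactness nor Hahn-Banach is used: norming vectors and functionals are
    replaced by rescaled vectors on which exactly half of a norm is taken, which is where the
    factors 1/2 come from. The functionals phi_n exist because every F_n is nonzero. The obstacle in
    the upper bound is that the modulus is not injective (f and - f have the same one), so a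
    separated pair in X^* need not give a separated pair in E^*. The argument is therefore centred
    at a single f0: if the modulus of f0 is not in the derivation, then all moduli of functionals
    weak-star close to f0 are within del of it in norm. Small tails are needed at f0 only; those of
    a nearby f are controlled through its modulus. The distance from f to f0 is then at most del
    (head) + 2 del (tail of f0) + 4 del (tail of f) + del (truncation of x) = 8 del, and two such f
    are within 16 del of each other. *)

Definition of_real (R : realType) (k : scalar_kind) : R -> scalar_field R k :=
  match k with
  | RealScalars => fun r => r
  | ComplexScalars => fun r => real_complex R r
  end.

(** * Real numbers inside the scalar field *)

Section OfReal.
Variables (R : realType) (k : scalar_kind).
Local Notation K := (scalar_field R k).
Local Notation sc := (@of_real R k).

Lemma of_real_is_zmod_morphism : zmod_morphism sc.
Proof. by case: k => //= x y; exact: rmorphB. Qed.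

HB.instance Definition _ := GRing.isZmodMorphism.Build R K sc
  of_real_is_zmod_morphism.

Lemma of_real_is_monoid_morphism : monoid_morphism sc.
Proof. by case: k; split => //= x y; exact: rmorphM. Qed.

HB.instance Definition _ := GRing.isMonoidMorphism.Build R K sc
  of_real_is_monoid_morphism.

Lemma ler_of_real a b : (sc a <= sc b) = (a <= b).
Proof. by case: k => //=; exact: lecR. Qed.

Lemma ltr_of_real a b : (sc a < sc b) = (a < b).
Proof. by case: k => //=; exact: ltcR. Qed.

Lemma of_real_gt0 a : (0 < sc a) = (0 < a).
Proof. by rewrite -(rmorph0 sc) ltr_of_real. Qed.

Lemma of_real_ge0 a : (0 <= sc a) = (0 <= a).
Proof. by rewrite -(rmorph0 sc) ler_of_real. Qed.

Lemma of_realK (x : K) : 0 <= x -> sc (real_part x) = x.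
Proof. by rewrite /real_part; case: k x => //= x /ger0_real/RRe_real. Qed.

Lemma norm_of_real (r : R) : 0 <= r -> `|sc r| = sc r.
Proof. by move=> r0; rewrite ger0_norm// of_real_ge0. Qed.

Lemma real_part_ge0 (x : K) : 0 <= x -> 0 <= real_part x.
Proof. by move=> x0; rewrite -of_real_ge0 of_realK. Qed.

Lemma real_part_le (x : K) (r : R) : 0 <= x -> (real_part x <= r) = (x <= sc r).
Proof. by move=> x0; rewrite -ler_of_real of_realK. Qed.

Lemma real_part_gt (x : K) (r : R) : 0 <= x -> (r < real_part x) = (sc r < x).
Proof. by move=> x0; rewrite -ltr_of_real of_realK. Qed.

(** The order of the complex field is partial, so a comparison can be negated only for scalars known
    to be real; norms are. *)
Lemma nneg_leNgt (x : K) r : 0 <= x -> (x <= sc r) = ~~ (sc r < x).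
Proof. by move=> x0; rewrite -real_part_le// -real_part_gt// leNgt. Qed.

Lemma nneg_ltNge (x : K) r : 0 <= x -> (sc r < x) = ~~ (x <= sc r).
Proof. by move=> x0; rewrite nneg_leNgt// negbK. Qed.

End OfReal.
#[global] Arguments of_real {R k} _.

(** * Basic weak-star neighbourhoods *)

Definition weak_close (K : numFieldType) (X : normedModType K)
  (s : seq X) (d : K) (f g : dual_space X) : Prop :=
  forall x, x \in s -> `|f x - g x| < d.

Section WeakStarBase.
Variables (K : numFieldType) (X : normedModType K).
Implicit Types (f g h : dual_space X) (s : seq X).

Definition weak_base f : set_system (dual_space X) :=
  [set V | exists s (d : K), 0 < d /\ forall g, weak_close s d f g -> V g].

Lemma weak_base_filter f : Filter (weak_base f).
Proof.
constructor.
- by exists [::], 1; split.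
- move=> P Q [s [d [d0 sP]]] [t [e [e0 tQ]]].
  (* In a partially ordered field the minimum is usable only for comparable elements; positive ones
     are. *)
  have de : (d >=< e) by apply: real_comparable; exact: gtr0_real.
  exists (s ++ t), (Num.min d e); split; first by rewrite comparable_lt_min// d0.
  move=> g gst; split; [apply: sP|apply: tQ] => x xs; have := gst x.
    by rewrite mem_cat xs comparable_lt_min// => /(_ isT)/andP[].
  by rewrite mem_cat xs orbT comparable_lt_min// => /(_ isT)/andP[].
- move=> P Q PQ [s [d [d0 sP]]]; exists s, d; split => // g /sP; exact: PQ.
Qed.

(** The topology is induced by pointwise convergence, so it is enough that the filter of basic
    neighbourhoods converges to f under each evaluation. *)
Lemma weak_base_nbhs f (U : set (dual_space X)) : nbhs f U -> weak_base f U.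
Proof.
case=> _ [[B Bop <-] /= Bf] BU.
pose T := fun g : dual_space X => (g : {ptws X -> K}).
have F := weak_base_filter f.
have cvT : {ptws, T @ weak_base f --> (f : X -> K)}.
  apply/cvg_sup => x; apply/cvg_image.
    by rewrite eqEsubset; split=> v // _; exists (cst v).
  have ex : (fun g : dual_space X => g x : K^o) @ weak_base f --> (f x : K^o).
    apply/cvgrPdist_lt => e e0; exists [:: x], e; split => // g; apply.
    by rewrite inE.
  move=> W /ex fW; exists (@^~ x @^-1` W) => //.
  by rewrite eqEsubset; split => [j [? + <-//]|j Wj]; exists (fun=> j).
have /cvT BT : nbhs (T f) B by apply: open_nbhs_nbhs; split.
move: BT; rewrite nbhs_simpl /= => BT.
exact: (@filterS _ _ F (T @^-1` B)).
Qed.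

Lemma evaluation_continuous (x : X) :
  continuous (fun f : dual_space X => f x : K).
Proof.
move=> f.
have c1 := @initial_continuous (dual_space X) {ptws X -> K}
  (fun g => (g : {ptws X -> K})) f.
have c2 := @proj_continuous X (fun=> K) x (f : {ptws X -> K}).
exact: (@continuous_comp (dual_space X) {ptws X -> K} K _ _ f c1 c2).
Qed.

Lemma weak_close_nbhs f s (d : K) :
  0 < d -> nbhs f [set g | weak_close s d f g].
Proof.
move=> d0; elim: s => [|x s IH].
  by apply: filterS filterT => g _ x.
have /cvgrPdist_lt/(_ d d0) ex := @evaluation_continuous x f.
apply: filterS2 ex IH => g gx gs y.
by rewrite inE => /predU1P[->//|]; exact: gs.
Qed.

End WeakStarBase.

(** * Szlenk derivations in terms of finitely many vectors *)

Section Szlenk.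
Variables (R : realType) (k : scalar_kind).
Local Notation K := (scalar_field R k).
Local Notation sc := (@of_real R k).
Variable X : normedModType K.
Implicit Types (f g h : dual_space X) (s : seq X) (A : set (dual_space X)).

Lemma norm_linear_bound (f : X -> K) (c : R) : linear (f : X -> K^o) ->
  (forall x, `|x| <= 1 -> `|f x| <= sc c) -> forall x, `|f x| <= sc c * `|x|.
Proof.
move=> fl fb x; have [->|x0] := eqVneq x 0.
  (* Linearity with scalar - 1 at 0 reads f 0 = - f 0 + f 0, hence f 0 = 0; the same device recurs
     below. *)
  have := fl (-1) 0 0; rewrite scaler0 addr0.
  by rewrite scaleN1r addNr => ->; rewrite !normr0 mulr0.
have nx0 : 0 < `|x| by rewrite normr_gt0.
have fZ a y : f (a *: y) = a * f y.
  have f0 : f 0 = 0.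
    have := fl (-1) 0 0; rewrite scaler0 addr0.
    by rewrite scaleN1r addNr.
  by have := fl a y 0; rewrite !addr0 f0 addr0.
have := fb (`|x|^-1 *: x); rewrite normrZ normfV normr_id mulVf ?gt_eqF//.
move=> /(_ (lexx _)); rewrite fZ normrM normfV normr_id.
by rewrite ler_pdivrMl// mulrC.
Qed.

Lemma op_norm_gt (f : X -> K) (c : R) :
  (c%:E < op_norm f)%E <-> exists2 x, `|x| <= 1 & sc c < `|f x|.
Proof.
split=> [/ereal_sup_gt[_ [x /= x1 <-]]|].
  by rewrite lte_fin real_part_gt// => h; exists x.
case=> x x1 cf; apply/ereal_sup_gtP; exists (real_part `|f x|)%:E; first by exists x.
by rewrite lte_fin real_part_gt.
Qed.

Lemma dual_ballP f : dual_ball f <-> forall x, `|f x| <= `|x|.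
Proof.
split=> [fb x|fb].
  rewrite -[leRHS]mul1r -(rmorph1 sc).
  apply: norm_linear_bound => [|y y1]; first exact: dual_linear.
  rewrite nneg_leNgt//; apply/negP => h.
  have : (1%:E < op_norm f)%E by apply/op_norm_gt; exists y.
  by rewrite ltNge fb.
rewrite /dual_ball /= leNgt; apply/negP => /op_norm_gt[x x1].
by rewrite rmorph1 => /lt_le_trans/(_ (fb x))/lt_le_trans/(_ x1); rewrite ltxx.
Qed.

Lemma dual_diam_gt (A : set (dual_space X)) (c : R) :
  (c%:E < dual_diam A)%E <->
  exists f g x, [/\ A f, A g, `|x| <= 1 & sc c < `|f x - g x|].
Proof.
split=> [/ereal_sup_gt[_ [f Af [g Ag <-]]] /op_norm_gt[x x1 h]|].
  by exists f, g, x.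
case=> f [g [x [Af Ag x1 h]]]; apply/ereal_sup_gtP; exists (op_norm (fun x => f x - g x)).
  by exists f => //; exists g.
by apply/op_norm_gt; exists x.
Qed.

(** The working form of the derivation: topology and extended reals disappear, and moving a
    derivation to another space only requires moving finite lists and one separating vector. *)
Lemma szlenk_derivationP (eps : R) A f :
  szlenk_derivation eps A f <-> A f /\ forall s (d : K), 0 < d ->
    exists g h x, [/\ A g, A h & [/\ weak_close s d f g, weak_close s d f h,
      `|x| <= 1 & sc eps < `|g x - h x|]].
Proof.
split=> -[Af H]; split=> //.
  move=> s d d0.
  have := @weak_close_nbhs _ _ f s d d0; rewrite nbhsE => -[U fU Us].
  have /dual_diam_gt[g [h [x [[Ag Ug] [Ah Uh] x1 e]]]] := H U fU.
  by exists g, h, x; split => //; split => //; exact: Us.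
move=> U /open_nbhs_nbhs/weak_base_nbhs[s [d [d0 sU]]].
have [g [h [x [Ag Ah [fg fh x1 e]]]]] := H s d d0.
by apply/dual_diam_gt; exists g, h, x; split => //; split => //; exact: sU.
Qed.

Lemma szlenk_derivation_sub eps A : szlenk_derivation eps A `<=` A.
Proof. by move=> f []. Qed.

Lemma szlenk_derivation_mono eps A B : A `<=` B ->
  szlenk_derivation eps A `<=` szlenk_derivation eps B.
Proof.
move=> AB f /szlenk_derivationP[Af H]; apply/szlenk_derivationP.
split=> [|s d /(H s)[g [h [x [Ag Ah ?]]]]]; first exact: AB.
by exists g, h, x; split => //; exact: AB.
Qed.

Lemma szlenk_iter_sub eps a A : szlenk_iter eps a A `<=` A.
Proof.
elim: a => [|a IH|I g IH] /=; [exact: subset_refl| |exact: subIsetl].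
by apply: subset_trans IH; exact: szlenk_derivation_sub.
Qed.

Lemma szlenk_iter_le eps a b A : ord_le a b ->
  szlenk_iter eps b A `<=` szlenk_iter eps a A.
Proof.
elim=> {a b} [b|a b _ IH|a I f i _ IH|I f b _ IH] /=.
- exact: szlenk_iter_sub.
- exact: szlenk_derivation_mono.
- move=> g [_ gf]; apply: IH; exact: gf.
- by move=> g bg; split => [|i _]; [exact: szlenk_iter_sub bg|exact: IH bg].
Qed.

Lemma szlenk_iter_nat_add eps m n A :
  szlenk_iter eps (ord_nat (m + n)) A =
  szlenk_iter eps (ord_nat m) (szlenk_iter eps (ord_nat n) A).
Proof. by elim: m => //= m ->. Qed.

(** Derivations are local: any test neighbourhood V of f may be shrunk to V [&] U. *)
Lemma szlenk_iter_localize eps n A U : open U ->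
  szlenk_iter eps (ord_nat n) A `&` U `<=`
  szlenk_iter eps (ord_nat n) (A `&` U).
Proof.
move=> Uop; elim: n => //= n IH f [[fA fH] Uf]; split; first by apply: IH.
move=> V [Vop Vf].
have /fH/dual_diam_gt[g [h [x [[gA [Vg Ug]] [hA [Vh Uh]] x1 e]]]] :
  open_nbhs f (V `&` U) by split; [exact: openI|split].
by apply/dual_diam_gt; exists g, h, x; split => //; split => //; apply: IH.
Qed.

End Szlenk.

(** Common source of rescaling, of monotonicity in eps and of the estimate for adjoints. Weak-star
    continuity is asked uniformly, as affine maps provide it. The modulus does not fit, since it
    need not separate separated pairs. *)
Lemma szlenk_iter_transport (R : realType) (k : scalar_kind)
    (X Y : normedModType (scalar_field R k)) (T : dual_space X -> dual_space Y)
    (eps del : R) (A : set (dual_space X)) (B : set (dual_space Y)) (n : nat) :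
  (forall f, A f -> B (T f)) ->
  (forall t (d : scalar_field R k), 0 < d -> exists s d', 0 < d' /\
     forall f g, A f -> A g -> weak_close s d' f g -> weak_close t d (T f) (T g)) ->
  (forall f g x, A f -> A g -> `|x| <= 1 -> of_real eps < `|f x - g x| ->
     exists2 y, `|y| <= 1 & of_real del < `|T f y - T g y|) ->
  forall f, szlenk_iter eps (ord_nat n) A f ->
    szlenk_iter del (ord_nat n) B (T f).
Proof.
move=> AB cT eT; elim: n => //= n IH f /szlenk_derivationP[fA H].
have sA := @szlenk_iter_sub _ _ _ eps (ord_nat n) A.
apply/szlenk_derivationP; split; first exact: IH.
move=> t d /(cT t)[s [d' [d'0 sd']]].
have [g [h [x [gA hA [fg fh x1 e]]]]] := H s d' d'0.
have [y y1 ey] := eT g h x (sA _ gA) (sA _ hA) x1 e.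
exists (T g), (T h), y; split; [exact: IH..|].
by split=> //; apply: sd' => //; exact: sA.
Qed.

(** * Comparison of ordinals with finite ones *)

Lemma ord_nat_le m n : (m <= n)%N -> ord_le (ord_nat m) (ord_nat n).
Proof.
elim: n m => [|n IH] [|m] //= mn; do ?exact: OrdLeZero.
by apply: OrdLeSucc; exact: IH.
Qed.

Lemma ord_nat_le_inv m n : ord_le (ord_nat m) (ord_nat n) -> (m <= n)%N.
Proof.
elim: m n => // m IH [|n] /= h; inversion h; subst; exact: IH.
Qed.

(** Needed in [szlenk_eps_nat], where the least finite vanishing index has to be least among all
    ordinals. *)
Lemma ord_nat_total b m : ord_le (ord_nat m.+1) b \/ ord_le b (ord_nat m).
Proof.
elim: b m => [|b IH|I f IH] m; first by right; exact: OrdLeZero.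
- case: m => [|m]; first by left; apply: OrdLeSucc; exact: OrdLeZero.
  by have [?|?] := IH m; [left|right]; exact: OrdLeSucc.
- have [[i hi]|H] := pselect (exists i, ord_le (ord_nat m.+1) (f i)).
    by left; exact: OrdLeSup hi.
  right; apply: OrdSupLe => i; have [hi|//] := IH i m.
  by exfalso; apply: H; exists i.
Qed.

(** * Affine contractions of the dual and finiteness of Szlenk numbers *)

Section SzlenkNumber.
Variables (R : realType) (k : scalar_kind).
Local Notation K := (scalar_field R k).
Local Notation sc := (@of_real R k).
Variable X : normedModType K.
Implicit Types (f g h : dual_space X) (A : set (dual_space X)).

Lemma dual_ext f g : (forall x, f x = g x) -> f = g.
Proof.
case: f g => [f fl fc] [g gl gc] /= fg.
have {}fg : f = g by exact: funext.
by subst g; congr DualSpace; exact: Prop_irrelevance.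
Qed.

Lemma dualD f x y : f (x + y) = f x + f y.
Proof. by have := dual_linear f 1 x y; rewrite !scale1r. Qed.

Lemma dual0 f : f 0 = 0.
Proof. by apply: (addrI (f 0)); rewrite -dualD !addr0. Qed.

Lemma dualZ f c x : f (c *: x) = c * f x.
Proof. by have := dual_linear f c x 0; rewrite !addr0 dual0 addr0. Qed.

Lemma dualB f x y : f (x - y) = f x - f y.
Proof. by rewrite -scaleN1r dualD dualZ mulN1r. Qed.

Lemma dual_sum f (I : Type) (r : seq I) (F : I -> X) :
  f (\sum_(i <- r) F i) = \sum_(i <- r) f (F i).
Proof. by elim/big_rec2: _ => [|i y x _ <-]; [exact: dual0|exact: dualD]. Qed.

Lemma shrink_linear (c : K) f g : linear ((fun x => c * (g x - f x)) : X -> K^o).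
Proof.
move=> a x y /=; rewrite !dualD !dualZ /GRing.scale/=; ring.
Qed.

Lemma shrink_continuous (c : K) f g : continuous (fun x => c * (g x - f x)).
Proof.
move=> x.
have fx : (fun x => f x : K^o) @ x --> (f x : K^o) by exact: dual_continuous.
have gx : (fun x => g x : K^o) @ x --> (g x : K^o) by exact: dual_continuous.
apply: (@cvgM K X (nbhs x) _ (fun=> c) (fun x => g x - f x)); first exact: cvg_cst.
exact: (cvgB gx fx).
Qed.

(** Recentring at f followed by scaling: c = 1/2 keeps the unit ball inside itself and sends f to 0,
    and c = 1/eps blows a piece of diameter eps up to the unit ball. *)
Definition shrink (c : K) f g : dual_space X :=
  DualSpace (shrink_linear c f g) (@shrink_continuous c f g).

Lemma shrink_iter (c : R) (eps : R) f (n : nat) A (B : set (dual_space X)) :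
  0 < c -> (forall g, A g -> B (shrink (sc c) f g)) ->
  forall g, szlenk_iter eps (ord_nat n) A g ->
    szlenk_iter (c * eps) (ord_nat n) B (shrink (sc c) f g).
Proof.
move=> c0 AB; have c0' : 0 < sc c by rewrite of_real_gt0.
have shrinkB g h x : shrink (sc c) f g x - shrink (sc c) f h x =
    sc c * (g x - h x) by rewrite /=; ring.
apply: szlenk_iter_transport => // [t d d0|g h x _ _ x1 e].
  exists t, ((sc c)^-1 * d); split; first by rewrite mulr_gt0// invr_gt0.
  move=> g h _ _ gh x /gh.
  by rewrite shrinkB normrM gtr0_norm// ltr_pdivlMl.
exists x => //; rewrite shrinkB normrM gtr0_norm//.
by rewrite rmorphM ltr_pM2l.
Qed.

Lemma szlenk_iter_eps eps eps' n A : eps <= eps' ->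
  szlenk_iter eps' (ord_nat n) A `<=` szlenk_iter eps (ord_nat n) A.
Proof.
move=> ee f; apply: (@szlenk_iter_transport _ _ _ _ id) => //.
  by move=> t d d0; exists t, d.
move=> g h x _ _ x1 e; exists x => //; apply: le_lt_trans e.
by rewrite ler_of_real.
Qed.

Lemma dual_zero_linear : linear ((fun=> 0) : X -> K^o).
Proof. by move=> a x y /=; rewrite scaler0 addr0. Qed.

Lemma dual_zero_continuous : continuous ((fun=> 0) : X -> K).
Proof. by move=> x; exact: cvg_cst. Qed.

Definition dual_zero : dual_space X :=
  DualSpace dual_zero_linear dual_zero_continuous.

Lemma dual_zero_ball : dual_ball dual_zero.
Proof. by apply/dual_ballP => x; rewrite normr0. Qed.

(** Since f is in the ball, g |-> (g - f) / 2 maps the ball into itself; it sends f to 0 and halves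
    distances. A point that depends on n is thus replaced by one that does not. *)
Lemma szlenk_iter_half eps n f : szlenk_iter eps (ord_nat n) (@dual_ball _ _ X) f ->
  szlenk_iter (2^-1 * eps) (ord_nat n) (@dual_ball _ _ X) dual_zero.
Proof.
move=> fn; have /dual_ballP fb := szlenk_iter_sub fn.
have -> : dual_zero = shrink (sc 2^-1) f f.
  by apply: dual_ext => x /=; rewrite subrr mulr0.
apply: shrink_iter fn => [|g /dual_ballP gb]; first by rewrite invr_gt0.
apply/dual_ballP => x /=; rewrite fmorphV rmorph_nat normrM normfV normr_nat.
rewrite ler_pdivrMl// mulr_natl mulr2n.
by apply: le_trans (ler_normB _ _) _; exact: lerD.
Qed.

Definition finite_szlenk := forall eps : R, 0 < eps ->
  exists n, szlenk_iter eps (ord_nat n) (@dual_ball _ _ X) = set0.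

(* If every finite iterate of the eps-derivation is nonempty, then averaging a
   point f of it with - f puts 0 in the (eps/2)-iterate, hence 0 survives
   omega derivations: no weak-star compactness is needed. *)
Lemma szlenk_omega_finite : is_szlenk X ord_omega -> finite_szlenk.
Proof.
move=> [H _] eps eps0; apply: contrapT => /forallNP ne.
have e2 : 0 < 2^-1 * eps by rewrite mulr_gt0// invr_gt0.
have [b [b0 _] /(@szlenk_iter_le _ _ _ (2^-1 * eps) _ _ (@dual_ball _ _ X)) bw] := H _ e2.
have : (set0 : set (dual_space X)) dual_zero.
  rewrite -b0; apply: bw; split; first exact: dual_zero_ball.
  move=> n _; have /eqP/set0P[f fn] := ne n; exact: szlenk_iter_half fn.
by [].
Qed.

Lemma szlenk_eps_nat eps n : szlenk_iter eps (ord_nat n) (@dual_ball _ _ X) = set0 ->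
  exists2 m, (m <= n)%N & is_szlenk_eps X eps (ord_nat m).
Proof.
move=> n0.
pose P m := `[< szlenk_iter eps (ord_nat m) (@dual_ball _ _ X) = set0 >].
have exP : exists m, P m by exists n; exact/asboolP.
case: (ex_minnP exP) => m /asboolP m0 mmin; exists m.
  by apply: mmin; exact/asboolP.
split=> // b b0; case: m m0 mmin => [|m] m0 mmin; first exact: OrdLeZero.
(* If b were at most m, the m-th iterate would already be empty, against the minimality of m.+1. *)
have [//|/(@szlenk_iter_le _ _ _ eps _ _ (@dual_ball _ _ X))] := ord_nat_total b m.
rewrite b0 subset0 => m1; suff : (m.+1 <= m)%N by rewrite ltnn.
by apply: mmin; exact/asboolP.
Qed.

End SzlenkNumber.

(** * Monotonicity and submultiplicativity of finite Szlenk numbers *)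

Section SzlenkNat.
Variables (R : realType) (k : scalar_kind).
Local Notation K := (scalar_field R k).
Local Notation sc := (@of_real R k).
Variable X : normedModType K.
Local Notation ball := (@dual_ball R k X).
Implicit Types (eps del : R) (A : set (dual_space X)).

Lemma szlenk_natE eps n : is_szlenk_eps X eps (ord_nat n) -> szlenk_nat X eps = n.
Proof.
move=> hn; rewrite /szlenk_nat; case: xgetP => [m _ hm|/(_ n)//].
by apply/eqP; rewrite eqn_leq; apply/andP; split; apply: ord_nat_le_inv;
  [apply: hm.2 hn.1|apply: hn.2 hm.1].
Qed.

Lemma szlenk_nat_le eps n :
  szlenk_iter eps (ord_nat n) ball = set0 -> (szlenk_nat X eps <= n)%N.
Proof. by move=> /szlenk_eps_nat[m mn /szlenk_natE ->]. Qed.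

Hypothesis fX : finite_szlenk X.

Lemma szlenk_natP eps : 0 < eps -> is_szlenk_eps X eps (ord_nat (szlenk_nat X eps)).
Proof.
by move=> /fX[n /szlenk_eps_nat[m _ hm]]; rewrite (szlenk_natE hm).
Qed.

Lemma szlenk_nat_gt0 eps : 0 < eps -> (0 < szlenk_nat X eps)%N.
Proof.
move=> /szlenk_natP[+ _]; case: (szlenk_nat X eps) => //= b0.
suff : (set0 : set (dual_space X)) (dual_zero X) by [].
by rewrite -b0; exact: dual_zero_ball.
Qed.

(** The supremum over eps is itself a tree, because [OrdSup] can be indexed by the type of positive
    reals. *)
Lemma finite_is_szlenk : exists2 alpha, is_szlenk X alpha & ord_le alpha ord_omega.
Proof.
exists (OrdSup (fun e : {e : R | 0 < e} => ord_nat (szlenk_nat X (sval e)))).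
  split=> [eps eps0|gamma H].
    exists (ord_nat (szlenk_nat X eps)); first exact: szlenk_natP.
    by apply: (OrdLeSup (i := exist _ eps eps0)); exact: ord_nat_le.
  by apply: OrdSupLe => -[e e0]; exact: H (szlenk_natP e0).
apply: OrdSupLe => -[e e0] /=.
by apply: (OrdLeSup (i := szlenk_nat X e)); exact: ord_nat_le.
Qed.

Lemma szlenk_nat_mono eps eps' : 0 < eps -> eps <= eps' ->
  (szlenk_nat X eps' <= szlenk_nat X eps)%N.
Proof.
move=> e0 ee; apply: szlenk_nat_le; rewrite -subset0.
have [<- _] := szlenk_natP e0; exact: szlenk_iter_eps.
Qed.

(* If f has a weak-star neighbourhood U with diam (A `&` U) <= eps, then
   (A `&` U - f) / eps lies in the unit ball. *)
Lemma szlenk_iter_mul_sub eps del m A : 0 < eps ->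
  szlenk_iter del (ord_nat m) ball = set0 ->
  szlenk_iter (eps * del) (ord_nat m) A `<=` szlenk_derivation eps A.
Proof.
move=> e0 m0 f fm; have Af := szlenk_iter_sub fm.
split => // U Uf; rewrite ltNge; apply/negP => dU.
have fAU := szlenk_iter_localize Uf.1 (conj fm Uf.2).
suff : (set0 : set (dual_space X)) (shrink (sc eps^-1) f f) by [].
rewrite -m0 -[X in szlenk_iter X](mulKf (lt0r_neq0 e0)).
apply: shrink_iter fAU => [|g [Ag Ug]]; first by rewrite invr_gt0.
apply/dual_ballP => x /=; rewrite -[leRHS]mul1r -(rmorph1 sc).
apply: (norm_linear_bound (f := shrink (sc eps^-1) f g)) => [|y y1].
  exact: shrink_linear.
rewrite /= normrM norm_of_real; last by rewrite invr_ge0 ltW.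
rewrite fmorphV.
rewrite ler_pdivrMl ?of_real_gt0// rmorph1 mulr1 nneg_leNgt//; apply/negP => h.
suff : (eps%:E < dual_diam (A `&` U))%E by rewrite ltNge dU.
by apply/dual_diam_gt; exists g, f, y; split => //; split => //; exact: Uf.2.
Qed.

(** The derivations are grouped in blocks of m: a block with parameter eps * del removes at least
    what one derivation with parameter eps removes. *)
Lemma szlenk_iter_mul eps del m n A : 0 < eps ->
  szlenk_iter del (ord_nat m) ball = set0 ->
  szlenk_iter (eps * del) (ord_nat (m * n)) A `<=` szlenk_iter eps (ord_nat n) A.
Proof.
move=> e0 m0; elim: n => [|n IH]; first by rewrite muln0; exact: subset_refl.
rewrite mulnS szlenk_iter_nat_add; apply: subset_trans.
  exact: szlenk_iter_mul_sub.
exact: szlenk_derivation_mono.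
Qed.

Lemma szlenk_nat_submul eps del : 0 < eps -> 0 < del ->
  (szlenk_nat X (eps * del) <= szlenk_nat X del * szlenk_nat X eps)%N.
Proof.
move=> e0 d0; apply: szlenk_nat_le; rewrite -subset0.
have [<- _] := szlenk_natP e0; apply: szlenk_iter_mul => //.
by have [] := szlenk_natP d0.
Qed.

End SzlenkNat.

(** * Existence of the limit defining the power type *)

Section PowerType.
Variable R : realType.

(* Fekete's lemma for t |-> L (exp (- t)). *)
Lemma subadditive_power_type (L : R -> R) :
  (forall e, 0 < e -> 0 <= L e) ->
  (forall e e', 0 < e -> e <= e' -> L e' <= L e) ->
  (forall e d, 0 < e -> 0 < d -> L (e * d) <= L e + L d) ->
  exists p : R, L e / `|ln e| @[e --> 0^'+] --> p.
Proof.
move=> L0 Lmono Lsub.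
pose S := [set L e / `|ln e| | e in [set e : R | 0 < e < 1]].
have lnn (e : R) : 0 < e < 1 -> 0 < `|ln e|.
  by move=> e1; rewrite normr_gt0 lt_eqF// ln_lt0.
have lbS : lbound S 0.
  move=> _ [e /= e1 <-]; case/andP: (e1) => e0 _.
  by rewrite divr_ge0//; exact: L0.
have S0 : S !=set0.
  by exists (L 2^-1 / `|ln 2^-1|), 2^-1 => //=; apply/andP; split; lra.
have hS : has_inf S by split => //; exists 0.
have Lpow (e : R) n : 0 < e -> L (e ^+ n.+1) <= n.+1%:R * L e.
  move=> e0; elim: n => [|n IH]; first by rewrite expr1 mul1r.
  rewrite exprS (le_trans (Lsub _ _ e0 _)) ?exprn_gt0//.
  by rewrite -(natr1 n.+1) mulrDl mul1r addrC lerD2r.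
exists (inf S); apply/cvgrPdist_le => /= eta eta0.
have [_ [d /= d1 <-] dS] := inf_adherent (divr_gt0 eta0 (ltr0Sn R 1)) hS.
case/andP: (d1) => d0 d1'.
have Ld0 := L0 d d0.
(* Rounding |ln e| / |ln d| up to an integer costs one more L d; beyond M this is at most (eta / 2)
   |ln e|. *)
pose M := 2 * L d / eta + 1.
have M0 : 0 < M.
  by rewrite /M ltr_wpDl// divr_ge0 ?mulr_ge0// ltW.
near=> e.
have e0 : 0 < e by near: e; exact: nbhs_right_gt.
have eM : e < expR (- M) by near: e; apply: nbhs_right_lt; exact: expR_gt0.
have e1 : 0 < e < 1.
  by rewrite e0 (lt_trans eM)// -expR0 ltr_expR oppr_lt0.
have lne : M < `|ln e|.
  rewrite ltr0_norm ?ln_lt0// ltrNr -(expRK (- M)) ltr_ln ?posrE ?expR_gt0//.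
have le0 := lnn e e1; have ld0 := lnn d d1.
have lower : inf S <= L e / `|ln e| by apply: ge_inf; [exact: hS.2|exists e].
rewrite ler_distlC; apply/andP; split; last first.
  (* The largest exponent with d ^+ n >= e: the next power lies below e, and [Lmono] and [Lpow]
     apply to it. *)
  pose n := Num.truncn (`|ln e| / `|ln d|).
  have nle : n%:R <= `|ln e| / `|ln d|.
    by rewrite truncn_le divr_ge0.
  have ltn : `|ln e| / `|ln d| < n.+1%:R by exact: truncnS_gt.
  have de : d ^+ n.+1 <= e.
    rewrite -ler_ln ?posrE ?exprn_gt0// lnXn// -[ln d *+ _]mulr_natl.
    rewrite -(opprK (ln e)) -(ltr0_norm (ln_lt0 e1)) -[ln d]opprK.
    rewrite -(ltr0_norm (ln_lt0 d1)) mulrN lerN2 -ler_pdivrMr//.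
    exact: ltW.
  have Le : L e <= n.+1%:R * L d.
    by apply: le_trans (Lmono _ _ _ de) _; [rewrite exprn_gt0|exact: Lpow].
  rewrite ler_pdivrMr//; apply: (le_trans Le).
  have : n.+1%:R * L d <= (`|ln e| / `|ln d| + 1) * L d.
    by rewrite ler_wpM2r// -natr1 lerD2r.
  move/le_trans; apply.
  have h1 : L d / `|ln d| * `|ln e| <= (inf S + eta / 2) * `|ln e|.
    by rewrite ler_wpM2r ?ltW.
  have h2 : L d <= eta / 2 * `|ln e|.
    have : 2 * L d / eta <= `|ln e|.
      by apply: ltW; apply: le_lt_trans lne; rewrite lerDl.
    rewrite ler_pdivrMr// => h; rewrite mulrAC ler_pdivlMr//.
    by rewrite mulrC [leRHS]mulrC.
  have -> : (`|ln e| / `|ln d| + 1) * L d = L d / `|ln d| * `|ln e| + L d.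
    by ring.
  by rewrite [eta]splitr addrA [leRHS]mulrDl; exact: lerD.
by apply: le_trans lower; rewrite gerBl ltW.
Unshelve. all: by end_near. Qed.

End PowerType.

(** * Bounded coefficients in finite dimension *)

Section FiniteDimension.
Variables (R : realType) (k : scalar_kind).
Local Notation K := (scalar_field R k).
Local Notation sc := (@of_real R k).

(** Absolute convergence implies convergence in both scalar fields; in the complex one, real and
    imaginary parts are summed separately, each being dominated by the modulus. *)
Lemma scalar_series_cvg (c : nat -> K) (b : nat -> R) :
  (forall n, `|c n| <= sc (b n)) -> cvgn (series b) ->
  exists l : K, series c @ \oo --> (l : K^o).
Proof.
have real_cvg (u v : nat -> R) : (forall n, `|u n| <= v n) ->
    cvgn (series v) -> cvgn (series u).
  move=> uv cv; apply: normed_cvg.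
  by apply: (series_le_cvg _ _ uv cv) => n //; exact: le_trans (uv n).
move=> cb bc.
suff [l hl] : exists l : K, forall e : K, 0 < e ->
    \forall n \near \oo, `|l - series c n| < e.
  by exists l; exact/cvgrPdist_lt.
case: k c cb => /= c cb.
  by exists (limn (series c)); apply/cvgrPdist_lt; exact: real_cvg cb bc.
have reb n : `|complex.Re (c n)| <= b n.
  by rewrite -lecR; apply: le_trans (cb n); exact: normc_ge_Re.
have imb n : `|complex.Im (c n)| <= b n.
  (* Up to sign the imaginary part is the real part after multiplication by i, which does not change
     the modulus. *)
  rewrite -lecR; apply: le_trans (cb n).
  have := normc_ge_Re (c n * 'i%C); rewrite ReiNIm normrN normrM.
  by rewrite [`|'i%C|]normc_def /= expr0n expr1n add0r sqrtr1 mulr1.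
pose lr := limn (series (fun n => complex.Re (c n))).
pose li := limn (series (fun n => complex.Im (c n))).
have /cvgrPdist_lt cr : series (fun n => complex.Re (c n)) @ \oo --> lr.
  exact: real_cvg reb bc.
have /cvgrPdist_lt ci : series (fun n => complex.Im (c n)) @ \oo --> li.
  exact: real_cvg imb bc.
exists (lr +i* li)%C => e e0.
have [r r0 er] : exists2 r, 0 < r & e = (real_complex R r).
  exists (complex.Re e); last by rewrite RRe_real// gtr0_real.
  by rewrite -ltcR RRe_real// gtr0_real.
have r2 : 0 < r / 2 by rewrite divr_gt0.
have Res n : complex.Re (series c n) = series (fun n => complex.Re (c n)) n.
  rewrite /series /=; elim: n => [|m IH]; first by rewrite !big_geq.
  by rewrite !big_nat_recr //= -IH; case: (\sum_(_ <= _ < _) _) => a b'; case: (c m).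
have Ims n : complex.Im (series c n) = series (fun n => complex.Im (c n)) n.
  rewrite /series /=; elim: n => [|m IH]; first by rewrite !big_geq.
  by rewrite !big_nat_recr //= -IH; case: (\sum_(_ <= _ < _) _) => a b'; case: (c m).
near=> n.
have hi : `|li - series (fun n => complex.Im (c n)) n| < r / 2.
  by near: n; exact: ci.
have hr : `|lr - series (fun n => complex.Re (c n)) n| < r / 2.
  by near: n; exact: cr.
have -> : (lr +i* li)%C - series c n =
    real_complex R (lr - series (fun n => complex.Re (c n)) n) +
    'i%C * real_complex R (li - series (fun n => complex.Im (c n)) n).
  rewrite -Res -Ims [LHS]complexE; congr (real_complex R _ + 'i%C * real_complex R _);
  by case: (series c n).
apply: le_lt_trans (ler_normD _ _) _.
rewrite normrM [`|'i%C|]normc_def /= expr0n expr1n add0r sqrtr1 mul1r.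
rewrite er [ltRHS](_ : _ = real_complex R (r / 2) + real_complex R (r / 2)); last first.
  by rewrite -rmorphD -splitr.
have nR (x : R) : `|real_complex R x| = real_complex R `|x|.
  by rewrite normc_def /= expr0n addr0 sqrtr_sqr.
by rewrite !nR; apply: ltrD; rewrite ltcR.
Unshelve. all: by end_near. Qed.

Variable V : normedModType K.

(** The b i may be dependent, hence the freedom to choose new coefficients. In the induction, either
    b m is a combination of the previous vectors and is eliminated, or it has positive distance d to
    their span: otherwise it would be a limit of elements of the span, and the bound for m makes
    that span closed. *)
Lemma coef_bound (b : nat -> V) (m : nat) : exists2 C : K, 0 <= C &
  forall c : nat -> K, exists2 c' : nat -> K,
    \sum_(i < m) c i *: b i = \sum_(i < m) c' i *: b i &
    forall i, (i < m)%N -> `|c' i| <= C * `|\sum_(i < m) c i *: b i|.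
Proof.
elim: m => [|m [C C0 IH]].
  by exists 0 => // c; exists c.
have [[c0 bE]|ne] := pselect (exists c0 : nat -> K, b m = \sum_(i < m) c0 i *: b i).
  exists C => // c; have [c' cE cb] := IH (fun i => c i + c m * c0 i).
  have sE : \sum_(i < m.+1) c i *: b i = \sum_(i < m) (c i + c m * c0 i) *: b i.
    rewrite big_ord_recr /= bE scaler_sumr -big_split /=.
    by apply: eq_bigr => i _; rewrite scalerDl scalerA.
  exists (fun i => if (i < m)%N then c' i else 0).
    rewrite sE cE big_ord_recr /= ltnn scale0r addr0.
    by apply: eq_bigr => i _; rewrite ltn_ord.
  move=> i _; rewrite sE; case: ifPn => [/cb//|_].
  by rewrite normr0 mulr_ge0.
have [d d0 db] : exists2 d : K, 0 < d &
    forall c : nat -> K, d <= `|b m - \sum_(i < m) c i *: b i|.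
  apply: contrapT => H; apply: ne.
  have H2 (n : nat) : exists c : nat -> K,
      `|b m - \sum_(i < m) c i *: b i| < sc (2^-1 ^+ n).
    apply: contrapT => H3; apply: H; exists (sc (2^-1 ^+ n)).
      by rewrite of_real_gt0 exprn_gt0// invr_gt0.
    move=> c; rewrite real_leNgt ?ger0_real ?of_real_ge0 ?exprn_ge0 ?invr_ge0//.
    by apply/negP => h; apply: H3; exists c.
  have [c cb] := choice H2.
  pose y n := \sum_(i < m) c n i *: b i.
  have yB n : `|y n.+1 - y n| <= sc (2 * 2^-1 ^+ n).
    rewrite -(subrKA (b m)) (le_trans (ler_normD _ _))// mulr_natl mulr2n rmorphD.
    apply: lerD; last exact: ltW (cb n).
    rewrite distrC; apply: le_trans (ltW (cb n.+1)) _.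
    by rewrite ler_of_real exprS ler_piMl ?exprn_ge0 ?invr_ge0// invf_le1// ler1n.
  (* The coefficients [c n] of y n need not converge; those chosen here for the increments are
     summable, and their sums D correct [c 0]. *)
  have dd_ex (n : nat) : exists e : nat -> K, y n.+1 - y n = \sum_(i < m) e i *: b i /\
      forall i, (i < m)%N -> `|e i| <= C * `|y n.+1 - y n|.
    have sE : \sum_(i < m) (c n.+1 i - c n i) *: b i = y n.+1 - y n.
      by rewrite -sumrB; apply: eq_bigr => i _; rewrite scalerBl.
    by have [c' + +] := IH (fun i => c n.+1 i - c n i); rewrite sE => ? ?; exists c'.
  have [dd dP] := choice dd_ex.
  have D_ex (i : nat) : exists D : K, (i < m)%N -> series (dd^~ i) @ \oo --> (D : K^o).
    have [im|_] := ltnP i m; last by exists 0.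
    have [||l hl] := @scalar_series_cvg (dd^~ i) (geometric (real_part C * 2) 2^-1).
    - move=> n; apply: (le_trans ((dP n).2 i im)).
      rewrite /= /geometric /= -mulrA rmorphM /= of_realK//.
      by rewrite ler_wpM2l.
    - by apply: is_cvg_geometric_series; rewrite ger0_norm ?invr_ge0// invf_lt1// ltr1n.
    by exists l.
  have [D DP] := choice D_ex.
  exists (fun i => c 0%N i + D i).
  have cvy : y @ \oo --> b m.
    apply/cvgrPdist_lt => e e0.
    have h2 : (fun n => 2^-1 ^+ n : R) @ \oo --> 0.
      by apply: cvg_expr; rewrite ger0_norm ?invr_ge0// invf_lt1// ltr1n.
    have re0 : 0 < real_part e by rewrite -(of_real_gt0 k) of_realK// ltW.
    have /cvgrPdist_lt/(_ _ re0) := h2.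
    apply: filterS => n; rewrite sub0r normrN ger0_norm ?exprn_ge0 ?invr_ge0//.
    move=> h; apply: lt_trans (cb n) _.
    by rewrite -[ltRHS](@of_realK R k) ?ltr_of_real// ltW.
  have yE n : y n = y 0%N + \sum_(i < m) series (dd^~ i) n *: b i.
    have -> : y n = y 0%N + series (fun n => y n.+1 - y n) n.
      by rewrite /series /= telescope_sumr// addrCA subrr addr0.
    congr (_ + _); rewrite /series /= (eq_bigr (fun n => \sum_(i < m) dd n i *: b i)).
      by rewrite exchange_big /=; apply: eq_bigr => i _; rewrite scaler_suml.
    by move=> j _; exact: (dP j).1.
  have cvS j : (j <= m)%N -> (fun n => \sum_(i < j) series (dd^~ i) n *: b i) @ \oo -->
      \sum_(i < j) D i *: b i.
    elim: j => [_|j IHj jm].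
      by rewrite big_ord0; under eq_fun do rewrite big_ord0; exact: cvg_cst.
    rewrite big_ord_recr /=; under eq_fun do rewrite big_ord_recr /=.
    have cvj : (fun n => series (dd^~ j) n *: b j) @ \oo --> D j *: b j.
      by apply: cvgZr_tmp; exact: DP jm.
    have cvSj := cvgD (IHj (ltnW jm)) cvj; exact: cvSj.
  have cvy' : y @ \oo --> y 0%N + \sum_(i < m) D i *: b i.
    apply: cvg_trans (cvgD (cvg_cst (y 0%N)) (cvS _ (leqnn m))).
    by apply: near_eq_cvg; apply: nearW => n; rewrite [RHS]yE.
  rewrite (cvg_unique _ cvy cvy')//= -big_split /=.
  by apply: eq_bigr => i _; rewrite scalerDl.
(* The first term bounds the last coefficient; the second bounds the others, which belong to v - c m
   *: b m, of norm at most (1 + |b m| / d) |v|. *)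
exists (d^-1 + C * (1 + d^-1 * `|b m|)).
  by rewrite addr_ge0 ?invr_ge0 ?mulr_ge0 ?addr_ge0 ?mulr_ge0 ?invr_ge0// ltW.
move=> c; set v := \sum_(i < m.+1) _.
have cm : `|c m| <= d^-1 * `|v|.
  rewrite ler_pdivlMl//; have [->|cm0] := eqVneq (c m) 0.
    by rewrite normr0 mulr0.
  (* Once c m is factored out, there remains b m minus an element of the span, of norm at least
     d. *)
  have -> : v = c m *: (b m - \sum_(i < m) (- (c m)^-1 * c i) *: b i).
    rewrite scalerBr /v big_ord_recr /= addrC; congr (_ + _).
    rewrite scaler_sumr -sumrN; apply: eq_bigr => i _.
    by rewrite scalerA -scaleNr mulNr mulrN opprK mulrA mulfV// mul1r.
  by rewrite normrZ mulrC ler_wpM2l//; exact: (db (fun i => - (c m)^-1 * c i)).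
have [c' wE cb] := IH c.
have wv : `|\sum_(i < m) c i *: b i| <= (1 + d^-1 * `|b m|) * `|v|.
  have -> : \sum_(i < m) c i *: b i = v - c m *: b m.
    by rewrite /v big_ord_recr /= addrK.
  rewrite (le_trans (ler_normB _ _))// mulrDl mul1r lerD2l normrZ mulrAC.
  by rewrite ler_wpM2r.
exists (fun i => if (i < m)%N then c' i else c m).
  rewrite /v !big_ord_recr /= ltnn wE; congr (_ + _).
  by apply: eq_bigr => i _; rewrite ltn_ord.
move=> i; rewrite ltnS mulrDl => im; case: ifPn => [{}im|_].
  apply: le_trans (cb i im) _; rewrite -[leLHS]add0r; apply: lerD.
    by rewrite mulr_ge0// invr_ge0 ltW.
  by rewrite -mulrA ler_wpM2l.
rewrite -[leLHS]addr0; apply: lerD => //.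
by rewrite !mulr_ge0// addr_ge0// mulr_ge0// invr_ge0 ltW.
Qed.

End FiniteDimension.

(** * Norms of functionals as real numbers *)

Section FunctionalNorm.
Variables (R : realType) (k : scalar_kind).
Local Notation K := (scalar_field R k).
Local Notation sc := (@of_real R k).
Variable V : normedModType K.
Implicit Types (f g : V -> K) (C : R).

(** Real valued, unlike [op_norm], so that it can serve as a coefficient; it is meaningful under
    [norm_bounded]. *)
Definition functional_norm f : R :=
  sup [set real_part `|f y| | y in [set y : V | `|y| <= 1]].

Definition norm_bounded f := exists C : R, forall y : V, `|y| <= 1 -> `|f y| <= sc C.

Let values f := [set real_part `|f y| | y in [set y : V | `|y| <= 1]].

Let values_n0 f : values f !=set0.
Proof. by exists (real_part `|f 0|); exists 0 => //=; rewrite normr0. Qed.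

Lemma functional_norm_le f C : (forall y : V, `|y| <= 1 -> `|f y| <= sc C) ->
  functional_norm f <= C.
Proof.
move=> fC; apply: ge_sup; first exact: (values_n0 f).
move=> _ [y /= y1 <-].
by rewrite real_part_le//; exact: fC.
Qed.

Lemma functional_norm_ge f (y : V) : norm_bounded f -> `|y| <= 1 ->
  `|f y| <= sc (functional_norm f).
Proof.
move=> [C fC] y1; rewrite -real_part_le//; apply: sup_upper_bound; last by exists y.
split; first exact: (values_n0 f).
by exists C => _ [z /= z1 <-]; rewrite real_part_le//; exact: fC.
Qed.

Lemma functional_norm_ge0 f : norm_bounded f -> 0 <= functional_norm f.
Proof.
move=> fb; rewrite -(of_real_ge0 k); apply: le_trans (normr_ge0 (f 0)) _.
by apply: functional_norm_ge => //; rewrite normr0.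
Qed.

Lemma functional_norm_bound f (y : V) : linear (f : V -> K^o) -> norm_bounded f ->
  `|f y| <= sc (functional_norm f) * `|y|.
Proof.
by move=> fl fb; apply: norm_linear_bound => // z z1; exact: functional_norm_ge.
Qed.

(** A value below the norm is exceeded somewhere on the ball and is then hit exactly after scaling
    down. An exact value is wanted because it prescribes the values of linear maps. *)
Lemma functional_norm_attained_half f : linear (f : V -> K^o) -> norm_bounded f ->
  exists2 u : V, `|u| <= 1 & f u = sc (functional_norm f / 2).
Proof.
move=> fl fb; have f0 : f 0 = 0.
  by have := fl (-1) 0 0; rewrite scaler0 addr0 scaleN1r addNr.
have [N0|N0] := eqVneq (functional_norm f) 0.
  by exists 0; rewrite ?normr0// f0 N0 mul0r rmorph0.
have Ngt0 : 0 < functional_norm f by rewrite lt_neqAle eq_sym N0 functional_norm_ge0.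
have [_ [y /= y1 <-]] : exists2 r, values f r & functional_norm f / 2 < r.
  apply: sup_gt; first exact: (values_n0 f).
  rewrite -/(functional_norm f) ltr_pdivrMr// mulrC.
  by rewrite mulr_natl mulr2n ltrDl.
rewrite real_part_gt// => fy.
have fy0 : f y != 0.
  rewrite -normr_eq0 gt_eqF//; apply: lt_trans fy.
  by rewrite of_real_gt0 divr_gt0.
exists ((sc (functional_norm f / 2) / f y) *: y).
  rewrite normrZ normrM normfV norm_of_real; last first.
    by rewrite divr_ge0 ?functional_norm_ge0.
  rewrite -[leRHS]mulr1; apply: ler_pM => //.
    by rewrite mulr_ge0 ?invr_ge0// of_real_ge0 divr_ge0 ?functional_norm_ge0.
  by rewrite ler_pdivrMr ?normr_gt0// mul1r ltW.
have := fl (sc (functional_norm f / 2) / f y) y 0.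
by rewrite f0 !addr0 => ->; rewrite /GRing.scale /= mulfVK.
Qed.

End FunctionalNorm.

(** * Spanning families and a norming functional *)

Section FiniteDimensionConsequences.
Variables (R : realType) (k : scalar_kind).
Local Notation K := (scalar_field R k).
Local Notation sc := (@of_real R k).
Variable V : normedModType K.

Let spanned m := exists b : nat -> V,
  forall x, exists c : nat -> K, x = \sum_(i < m) c i *: b i.

Lemma finite_dimensional_spanned : finite_dimensional V -> exists m, spanned m.
Proof.
case=> m [b bP]; exists m.
exists (fun n => if insub n is Some i then b i else 0) => x.
have [c ->] := bP x.
exists (fun n => if insub n is Some i then c i else 0).
by apply: eq_bigr => i _; rewrite !valK.
Qed.

(** Used to turn closeness of two functionals at finitely many vectors into closeness on the whole
    unit ball. *)
Lemma finite_dimensional_bounded_coefs : finite_dimensional V ->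
  exists m (b : nat -> V) (C : R), 0 <= C /\ forall x : V, `|x| <= 1 ->
    exists2 c : nat -> K, x = \sum_(i < m) c i *: b i &
      forall i, (i < m)%N -> `|c i| <= sc C.
Proof.
move=> /finite_dimensional_spanned[m [b bP]].
have [C C0 Cb] := coef_bound b m; exists m, b, (real_part C); split.
  exact: real_part_ge0.
move=> x x1; have [c xE] := bP x; have [c' cE cb] := Cb c.
exists c'; first by rewrite xE.
move=> i im; rewrite of_realK//; apply: le_trans (cb i im) _.
by rewrite -xE ler_piMr.
Qed.

(** In a spanning family of least length the last coefficient is unique, so it is a linear
    functional; it is bounded by [coef_bound], and dividing by its norm N turns the attained value N
    / 2 into 1/2. *)
Lemma finite_dimensional_functional : finite_dimensional V ->
  (exists x : V, x != 0) ->
  exists2 phi : V -> K, linear (phi : V -> K^o) /\ (forall y, `|phi y| <= `|y|) &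
    exists2 u, `|u| <= 1 & phi u = 2^-1.
Proof.
move=> /finite_dimensional_spanned[m0 m0P] [x0 x0n0].
pose P m := `[< spanned m >].
have exP : exists m, P m by exists m0; exact/asboolP.
case: (ex_minnP exP) => -[|m] /asboolP[b bP] mmin.
  by have [c] := bP x0; rewrite big_ord0 => x00; rewrite x00 eqxx in x0n0.
(* A relation with c m != 0 would eliminate b m and leave a shorter spanning family. *)
have indep (c : nat -> K) : \sum_(i < m.+1) c i *: b i = 0 -> c m = 0.
  move=> c0; apply: contrapT => /eqP cm0.
  suff : (m.+1 <= m)%N by rewrite ltnn.
  apply: mmin; apply/asboolP; exists b => x; have [d ->] := bP x.
  exists (fun i => d i - d m / c m * c i).
  move: c0; rewrite !big_ord_recr /= => /eqP; rewrite addrC addr_eq0 => /eqP bm.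
  have {}bm : b m = - (c m)^-1 *: \sum_(i < m) c i *: b i.
    by rewrite scaleNr -scalerN -bm scalerA mulVf// scale1r.
  rewrite bm scalerA scaler_sumr -big_split /=; apply: eq_bigr => i _.
  by rewrite scalerBl scalerA mulrN mulNr scaleNr.
have [C C0 Cb] := coef_bound b m.+1.
have cfP (y : V) : exists c : nat -> K, y = \sum_(i < m.+1) c i *: b i /\
    `|c m| <= C * `|y|.
  have [c yE] := bP y; have [c' cE cb] := Cb c; exists c'.
  by rewrite -cE -yE; split => //; rewrite yE; exact: cb.
have [cf cfE] := choice cfP.
pose phi0 y := cf y m.
(* The expansions are chosen vector by vector, without linearity; [indep] makes the last coefficient
   linear all the same. *)
have phi0l : linear (phi0 : V -> K^o).
  move=> a x y; apply/eqP; rewrite -subr_eq0; apply/eqP.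
  apply: (indep (fun i => cf (a *: x + y) i - (a * cf x i + cf y i))).
  under eq_bigr do rewrite scalerBl scalerDl -scalerA.
  rewrite sumrB big_split /= -scaler_sumr.
  by rewrite -(cfE x).1 -(cfE y).1 -(cfE (a *: x + y)).1 subrr.
have phi0b : norm_bounded phi0.
  exists (real_part C) => y y1; rewrite of_realK//.
  by apply: le_trans (cfE y).2 _; rewrite ler_piMr.
set N := functional_norm phi0.
have N0 : 0 < N.
  (* If N were 0, the last coefficient of b m would vanish, while comparison with the trivial
     expansion of b m shows that it is 1. *)
  rewrite lt_neqAle functional_norm_ge0// andbT; apply/eqP => N0.
  have := functional_norm_bound (b m) phi0l phi0b.
  rewrite -/N -N0 rmorph0 mul0r normr_le0 => /eqP phib.
  have := indep (fun i => (i == m)%:R - cf (b m) i).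
  under eq_bigr do rewrite scalerBl.
  rewrite sumrB -(cfE (b m)).1 big_ord_recr /= eqxx scale1r.
  rewrite big1 ?add0r ?subrr; last first.
    by move=> i _; rewrite ltn_eqF// scale0r.
  move=> /(_ erefl); rewrite -/(phi0 (b m)) phib subr0 => /eqP.
  by rewrite oner_eq0.
have [u u1 uE] := functional_norm_attained_half phi0l phi0b.
exists (fun y => (sc N)^-1 * phi0 y).
  split=> [a x y|y].
    by rewrite phi0l /GRing.scale /=; ring.
  rewrite normrM normfV norm_of_real ?(ltW N0)// ler_pdivrMl ?of_real_gt0//.
  exact: functional_norm_bound.
exists u => //; rewrite uE -/N rmorphM /= mulKf ?fmorphV ?rmorph_nat//.
by rewrite gt_eqF// of_real_gt0.
Qed.

End FiniteDimensionConsequences.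

Lemma bounded_linear_continuous (K : numFieldType) (V W : normedModType K)
    (f : V -> W) : linear f -> (forall x, `|f x| <= `|x|) -> continuous f.
Proof.
move=> fl fb x; apply/cvgrPdist_lt => d d0.
have /(@cvgrPdist_lt K V)/(_ d d0) : id y @[y --> x] --> x by exact: cvg_id.
apply: filterS => y; apply: le_lt_trans.
have -> : f x - f y = f (x - y) by have := fl (-1) y x;
  rewrite scaleN1r (addrC (- y)) => ->; rewrite scaleN1r addrC.
exact: fb.
Qed.

Section BoundedDual.
Variables (K : numFieldType) (V : normedModType K) (f : V -> K).
Hypotheses (fl : linear (f : V -> K^o)) (fb : forall x, `|f x| <= `|x|).

Lemma bounded_dual_continuous : continuous f.
Proof. exact: (bounded_linear_continuous (W := K^o) fl fb). Qed.

Definition bounded_dual : dual_space V := DualSpace fl bounded_dual_continuous.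

End BoundedDual.

(** * Expansions along an unconditional basis *)

Section BasisExpansion.
Variables (R : realType) (k : scalar_kind).
Local Notation K := (scalar_field R k).
Local Notation sc := (@of_real R k).
Variables (E : completeNormedModType K) (e : nat -> E).
Hypothesis he : normalized_1unconditional_basis e.
Implicit Types (x y : E) (a b : nat -> K).

Definition synthesis a : E := limn (series (fun n => a n *: e n)).

Definition summable_coefs a := cvgn (series (fun n => a n *: e n)).

Definition basis_coef x : nat -> K :=
  xget (fun=> 0) [set a | series (fun n => a n *: e n) @ \oo --> x].

Lemma basis_coefP x : series (fun n => basis_coef x n *: e n) @ \oo --> x.
Proof.
have [basis _ _] := he; have [a [ax _]] := basis x.
by rewrite /basis_coef; case: xgetP => [b -> //|/(_ a)].
Qed.

Lemma basis_coef_uniq x a :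
  series (fun n => a n *: e n) @ \oo --> x -> basis_coef x = a.
Proof.
move=> ax; have [basis _ _] := he; have [c [_ cu]] := basis x.
by rewrite -(cu _ ax) -(cu _ (@basis_coefP x)).
Qed.

Lemma basis_coef_cvg x : summable_coefs (basis_coef x).
Proof. exact: cvgP (@basis_coefP x). Qed.

Lemma basis_coefK x : synthesis (basis_coef x) = x.
Proof. exact: cvg_lim (@basis_coefP x). Qed.

Lemma synthesis_cvg a : summable_coefs a ->
  series (fun n => a n *: e n) @ \oo --> synthesis a.
Proof. by []. Qed.

Lemma synthesisK a : summable_coefs a -> basis_coef (synthesis a) = a.
Proof. by move=> /synthesis_cvg/basis_coef_uniq. Qed.

Lemma series_lin (t : K) a b (n : nat) :
  series (fun n => (t * a n + b n) *: e n) n =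
  t *: series (fun n => a n *: e n) n + series (fun n => b n *: e n) n.
Proof.
rewrite /series /= scaler_sumr -big_split /=.
by apply: eq_bigr => i _; rewrite scalerDl scalerA.
Qed.

Lemma cvg_lin (t : K) a b x y :
  series (fun n => a n *: e n) @ \oo --> x ->
  series (fun n => b n *: e n) @ \oo --> y ->
  series (fun n => (t * a n + b n) *: e n) @ \oo --> t *: x + y.
Proof.
move=> ax bx; rewrite (_ : series _ = t *: series (fun n => a n *: e n) +
  series (fun n => b n *: e n)); last by apply/funext => n; exact: series_lin.
by apply: cvgD => //; exact: cvgZl_tmp.
Qed.

Lemma synthesis_lin (t : K) a b : summable_coefs a -> summable_coefs b ->
  synthesis (fun n => t * a n + b n) = t *: synthesis a + synthesis b.
Proof.
move=> ca cb; apply: cvg_lim => //.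
by apply: cvg_lin; exact: synthesis_cvg.
Qed.

Lemma basis_coef_lin (t : K) x y n :
  basis_coef (t *: x + y) n = t * basis_coef x n + basis_coef y n.
Proof.
rewrite (@basis_coef_uniq _ (fun n => t * basis_coef x n + basis_coef y n))//.
by apply: cvg_lin; exact: basis_coefP.
Qed.

Lemma finite_support_cvg a N : (forall n, (N <= n)%N -> a n = 0) ->
  series (fun n => a n *: e n) @ \oo --> \sum_(i < N) a i *: e i.
Proof.
move=> aN; apply: cvg_near_cst; exists N => // n /= Nn.
rewrite /series /= (big_cat_nat _ Nn)//= big_mkord [X in _ + X]big_nat_cond.
by rewrite [X in _ + X]big1 ?addr0// => i /andP[/andP[Ni _] _]; rewrite aN// scale0r.
Qed.

Lemma basis_coef_basis n m : basis_coef (e n) m = (m == n)%:R.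
Proof.
rewrite (@basis_coef_uniq _ (fun m => (m == n)%:R))//.
have := @finite_support_cvg (fun m => (m == n)%:R) n.+1.
rewrite big_ord_recr /= eqxx scale1r big1 ?add0r; last first.
  by move=> i _; rewrite ltn_eqF// scale0r.
by apply=> j nj; rewrite gtn_eqF.
Qed.

Lemma basis_partial_cvg x (d : K) : 0 < d ->
  \forall N \near \oo, `|x - \sum_(i < N) basis_coef x i *: e i| < d.
Proof.
move=> d0; have /cvgrPdist_lt/(_ _ d0) := @basis_coefP x.
by apply: filterS => N; rewrite /series /= big_mkord.
Qed.

Lemma basis_partial_cvg_seq (s : seq E) (d : K) : 0 < d ->
  \forall N \near \oo, forall x, x \in s ->
    `|x - \sum_(i < N) basis_coef x i *: e i| < d.
Proof.
move=> d0; elim: s => [|x s IH]; first by apply: nearW.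
apply: filterS2 (basis_partial_cvg x d0) IH => N xN sN y.
by rewrite inE => /predU1P[->//|]; exact: sN.
Qed.

(** Truncating only decreases the moduli of the coefficients, so unconditionality in the limit
    applies. *)
Lemma synthesis_partial_le a (m n : nat) : summable_coefs a ->
  `|\sum_(m <= i < n) a i *: e i| <= `|synthesis a|.
Proof.
move=> ca; pose b i := if (m <= i < n)%N then a i else 0.
have bP : series (fun n => b n *: e n) @ \oo --> \sum_(m <= i < n) a i *: e i.
  rewrite (_ : \sum_(_ <= _ < _) _ = \sum_(i < n) b i *: e i).
    by apply: finite_support_cvg => i ni; rewrite /b ltnNge ni andbF.
  rewrite -(big_mkord xpredT (fun i => b i *: e i)) (big_nat_widenl m 0)// big_mkcond /=.
  rewrite !big_nat; apply: eq_bigr => i /= iN; rewrite /b iN andbT.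
  by case: ifP => //; rewrite scale0r.
rewrite -(cvg_lim _ bP)//; apply: dominated_lim => // i.
by rewrite /b; case: ifP => //; rewrite normr0.
Qed.

Lemma basis_coef_le x n : `|basis_coef x n| <= `|x|.
Proof.
have := @synthesis_partial_le _ n n.+1 (@basis_coef_cvg x).
by rewrite big_nat1 normrZ basis_coefK; have [_ _ ->] := he; rewrite mulr1.
Qed.

Section Mask.
Variable A : nat -> bool.

Definition mask_coef x n : K := if A n then basis_coef x n else 0.

Lemma mask_coef_cvg x : summable_coefs (mask_coef x).
Proof.
apply: (Defs.dominated_cvg he (a := mask_coef x) _ (@basis_coef_cvg x)) => n.
by rewrite /mask_coef; case: ifP => //; rewrite normr0.
Qed.

(** The coordinate projection P_A; for a 1-unconditional basis it is a contraction for every set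
    A. *)
Definition basis_mask x : E := synthesis (mask_coef x).

Lemma basis_mask_le x : `|basis_mask x| <= `|x|.
Proof.
rewrite -[x in leRHS]basis_coefK.
apply: (dominated_lim he (a := mask_coef x) _ (@basis_coef_cvg x)) => n.
by rewrite /mask_coef; case: ifP => //; rewrite normr0.
Qed.

Lemma basis_mask_linear : linear basis_mask.
Proof.
move=> t x y; rewrite /basis_mask -synthesis_lin; do ?exact: mask_coef_cvg.
congr synthesis; apply/funext => n; rewrite /mask_coef.
by case: ifP => _; rewrite ?basis_coef_lin// mulr0 addr0.
Qed.

Lemma basis_mask_basis n : basis_mask (e n) = if A n then e n else 0.
Proof.
rewrite /basis_mask; case: ifPn => An.
  rewrite -[RHS]basis_coefK; congr synthesis; apply/funext => m.
  rewrite /mask_coef basis_coef_basis; case: eqVneq => [->|_]; rewrite ?An//.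
  by case: ifP.
apply: cvg_lim => //; have := @finite_support_cvg (mask_coef (e n)) 0.
rewrite big_ord0; apply=> m _; rewrite /mask_coef basis_coef_basis.
by case: eqVneq => [->|_]; rewrite ?(negbTE An)//; case: ifP.
Qed.

End Mask.

End BasisExpansion.

(** * Finite Szlenk numbers make the basis shrinking *)

Section Shrinking.
Variables (R : realType) (k : scalar_kind).
Local Notation K := (scalar_field R k).
Local Notation sc := (@of_real R k).
Variables (E : completeNormedModType K) (e : nat -> E).
Hypothesis he : normalized_1unconditional_basis e.
Local Notation ball := (@dual_ball R k E).

Section MaskDual.
Variables (h : dual_space E) (hb : ball h) (A : nat -> bool).

Lemma mask_dual_linear : linear ((fun x => h (basis_mask e A x)) : E -> K^o).
Proof.
by move=> t x y; rewrite (basis_mask_linear he) dualD dualZ.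
Qed.

Lemma mask_dual_le x : `|h (basis_mask e A x)| <= `|x|.
Proof. by apply: le_trans (basis_mask_le he A x); exact: (dual_ballP _).1. Qed.

Definition mask_dual : dual_space E := bounded_dual mask_dual_linear mask_dual_le.

Lemma mask_dual_ball : ball mask_dual.
Proof. by apply/dual_ballP; exact: mask_dual_le. Qed.

Lemma mask_dual_sum (r : seq nat) (a : nat -> K) :
  mask_dual (\sum_(i <- r) a i *: e i) =
  \sum_(i <- r) a i * (if A i then h (e i) else 0).
Proof.
rewrite dual_sum; apply: eq_bigr => i _; rewrite dualZ; congr (_ * _).
by rewrite /= (basis_mask_basis he); case: ifP => // _; exact: dual0.
Qed.

End MaskDual.

(* James: if the tails of h do not tend to 0, the functionals h o P_A, with A
   eventually constant, survive every derivation: flipping A beyond N is a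
   weak-star small change, but changes h o P_A by a tail of h. *)
Lemma finite_szlenk_shrinking (h : dual_space E) (d : R) :
  finite_szlenk E -> ball h -> 0 < d ->
  exists N, forall M (a : nat -> K), `|\sum_(N <= i < M) a i *: e i| <= 1 ->
    `|h (\sum_(N <= i < M) a i *: e i)| <= sc d.
Proof.
move=> fE hb d0; apply: contrapT => H.
have tail N : exists M (a : nat -> K), `|\sum_(N <= i < M) a i *: e i| <= 1 /\
    sc d < `|h (\sum_(N <= i < M) a i *: e i)|.
  apply: contrapT => H1; apply: H; exists N => M a a1.
  rewrite nneg_leNgt//; apply/negP => h1; by apply: H1; exists M, a.
pose G := [set g | exists A : nat -> bool,
  (exists N, forall n, (N <= n)%N -> A n = A N) /\ g = mask_dual hb A].
have GS n : G `<=` szlenk_iter d (ord_nat n) ball.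
  elim: n => [|n IH] _ [A [[N0 AN0] ->]] /=; first exact: mask_dual_ball.
  apply/szlenk_derivationP; split; first by apply: IH; exists A; split => //; exists N0.
  move=> s t t0; have t2 : 0 < t / 2 by rewrite divr_gt0.
  have [N [NN0 sN]] : exists N, (N0 <= N)%N /\ forall x, x \in s ->
      `|x - \sum_(i < N) basis_coef e x i *: e i| < t / 2.
    have [N1 _ HN1] := basis_partial_cvg_seq he s t2.
    by exists (maxn N0 N1); split; [exact: leq_maxl|apply: HN1; exact: leq_maxr].
  have [M [a [w1 hw]]] := tail N.
  (* Below N nothing changes, so both functionals agree on the N-th partial sums of the vectors of
     s, and N was chosen to make the remainders smaller than t / 2. *)
  pose A' n := if (n < N)%N then A n else ~~ A n.
  set w := \sum_(N <= i < M) _ in w1 hw.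
  exists (mask_dual hb A), (mask_dual hb A'), w; split.
  - by apply: IH; exists A; split => //; exists N0.
  - apply: IH; exists A'; split => //; exists N => m Nm.
    by rewrite /A' ltnNge Nm /= ltnn (AN0 m) 1?(AN0 N)//; exact: leq_trans Nm.
  split => //.
  - by move=> x _; rewrite subrr normr0.
  - move=> x xs; set S := \sum_(i < N) basis_coef e x i *: e i.
    have SE : mask_dual hb A S = mask_dual hb A' S.
      rewrite /S -(big_mkord xpredT (fun i => basis_coef e x i *: e i)) !mask_dual_sum.
      by rewrite !big_nat; apply: eq_bigr => i /= iN; rewrite /A' iN.
    have -> : mask_dual hb A x - mask_dual hb A' x =
        mask_dual hb A (x - S) - mask_dual hb A' (x - S).
      by rewrite !dualB SE; ring.
    rewrite (le_lt_trans (ler_normB _ _))// [t]splitr; apply: ltrD.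
      exact: le_lt_trans (mask_dual_le hb A _) (sN x xs).
    exact: le_lt_trans (mask_dual_le hb A' _) (sN x xs).
  - suff -> : `|mask_dual hb A w - mask_dual hb A' w| = `|h w| by [].
    have -> : h w = \sum_(N <= i < M) a i * h (e i).
      by rewrite /w dual_sum; apply: eq_bigr => i _; rewrite dualZ.
    rewrite /w !mask_dual_sum -sumrB.
    (* Since N >= N0, A is constant from N on, so the two masks differ on w by h w up to one global
       sign. *)
    rewrite (eq_big_nat _ _ (F2 := fun i => (if A N0 then 1 else -1) * (a i * h (e i)))).
      by rewrite -mulr_sumr normrM; case: ifP; rewrite ?normrN1 ?normr1 mul1r.
    move=> i /andP[Ni _]; rewrite /A' ltnNge Ni /= (AN0 i); last exact: leq_trans Ni.
    by case: ifP => _ /=; ring.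
have [n n0] := fE d d0.
suff : (set0 : set (dual_space E)) (mask_dual hb (fun=> true)) by [].
by rewrite -n0; apply: GS; exists (fun=> true); split => //; exists 0%N.
Qed.

End Shrinking.

(** * Contractions between E and the direct sum *)

Section DirectSumMaps.
Variables (R : realType) (k : scalar_kind).
Local Notation K := (scalar_field R k).
Local Notation sc := (@of_real R k).
Variables (E : completeNormedModType K) (e : nat -> E).
Hypothesis he : normalized_1unconditional_basis e.
Variable F : nat -> completeNormedModType K.
Local Notation X := (direct_sum F he).

Definition coord_norms (x : X) : nat -> K := fun n => `|x n|.

Lemma coord_norms_cvg (x : X) : summable_coefs e (coord_norms x).
Proof. exact: dsum_cvg. Qed.

Lemma dsum_normE (x : X) : `|x| = `|synthesis e (coord_norms x)|.
Proof. by []. Qed.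

Lemma coord_norms_partial_le (x : X) (m n : nat) :
  `|\sum_(m <= i < n) coord_norms x i *: e i| <= `|x|.
Proof. exact: (synthesis_partial_le he m n (@coord_norms_cvg x)). Qed.

Lemma dsum_coord_le (x : X) n : `|x n| <= `|x|.
Proof.
have := coord_norms_partial_le x n n.+1.
by rewrite big_nat1 normrZ normr_id; have [_ _ ->] := he; rewrite mulr1.
Qed.

Lemma dsum_coordD (x y : X) n : (x + y) n = x n + y n.
Proof. by []. Qed.

Lemma dsum_coordZ (t : K) (x : X) n : (t *: x) n = t *: x n.
Proof. by []. Qed.

Lemma dsum_coordB (x y : X) n : (x - y) n = x n - y n.
Proof. by []. Qed.

Lemma dsum_coord_sum (I : Type) (r : seq I) (G : I -> X) n :
  (\sum_(i <- r) G i) n = \sum_(i <- r) G i n.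
Proof. by elim/big_rec2: _ => // i y x _ <-. Qed.

Lemma dsum_finite_cvg (c : forall n, F n) N : (forall n, (N <= n)%N -> c n = 0) ->
  series (fun n => `|c n| *: e n) @ \oo --> \sum_(i < N) `|c i| *: e i.
Proof.
move=> cN; apply: (@finite_support_cvg _ _ E e (fun n => `|c n|) N) => n /cN ->.
exact: normr0.
Qed.

Section Single.
Variable n : nat.

Definition single_coord (y : F n) : forall m, F m := eqtype.dfwith (fun m => 0 : F m) y.

Lemma single_coord_cvg (y : F n) :
  series (fun m => `|single_coord y m| *: e m) @ \oo --> `|y| *: e n.
Proof.
have := @dsum_finite_cvg (single_coord y) n.+1.
rewrite big_ord_recr /= /single_coord dfwith_in big1 ?add0r; last first.
  by move=> i _; rewrite dfwith_out ?normr0 ?scale0r// gtn_eqF.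
by apply=> m nm; rewrite dfwith_out// ltn_eqF.
Qed.

Definition single (y : F n) : X := DSum (cvgP _ (@single_coord_cvg y)).


Lemma single_in (y : F n) : single y n = y.
Proof. exact: dfwith_in. Qed.

Lemma single_out (y : F n) m : n != m -> single y m = 0.
Proof. by move=> nm; exact: dfwith_out. Qed.

Lemma single_norm (y : F n) : `|single y| = `|y|.
Proof.
rewrite dsum_normE /synthesis (cvg_lim _ (@single_coord_cvg y))// normrZ normr_id.
by have [_ _ ->] := he; rewrite mulr1.
Qed.

Lemma single_linear : linear (single : F n -> X).
Proof.
move=> t y z; apply: dsumP => m; rewrite dsum_coordD dsum_coordZ.
have [<-|nm] := eqVneq n m; first by rewrite !single_in.
by rewrite !single_out// scaler0 addr0.
Qed.

End Single.

(** The coordinate norms of the remainder are those of x with the first N replaced by 0, so its norm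
    is that of a remainder of the expansion of (|x_n|) in E. *)
Lemma dsum_partial_cvg (x : X) (d : K) : 0 < d ->
  \forall N \near \oo, `|x - \sum_(i < N) single (x i)| < d.
Proof.
move=> d0; apply: filterS (basis_partial_cvg he (synthesis e (coord_norms x)) d0) => N.
set z := synthesis _ _; apply: le_lt_trans.
rewrite (synthesisK he (@coord_norms_cvg x)) dsum_normE.
have tailE : series (fun n => coord_norms (x - \sum_(i < N) single (x i)) n *: e n)
    @ \oo --> z - \sum_(i < N) coord_norms x i *: e i.
  pose c n := if (n < N)%N then coord_norms x n else 0.
  have cE : series (fun n => c n *: e n) @ \oo --> \sum_(i < N) coord_norms x i *: e i.
    rewrite (eq_bigr (fun i : 'I_N => c i *: e i)) => [|i _]; last by rewrite /c ltn_ord.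
    by apply: finite_support_cvg => n Nn; rewrite /c ltnNge Nn.
  rewrite [X in series X](_ : _ = fun n => (-1 * c n + coord_norms x n) *: e n).
    rewrite (_ : z - _ = -1 *: (\sum_(i < N) coord_norms x i *: e i) + z); last first.
      by rewrite scaleN1r addrC.
    exact: (@cvg_lin _ _ E e (-1) _ _ _ _ cE (synthesis_cvg (@coord_norms_cvg x))).
  apply/funext => n; congr (_ *: _).
  rewrite mulN1r /c /coord_norms dsum_coordB dsum_coord_sum.
  have [nN|Nn] := ltnP n N.
    rewrite (_ : \sum_(i < N) _ = x n) ?subrr ?normr0 ?addNr//.
    rewrite (bigD1 (Ordinal nN))//= [X in _ + X]big1 => [|i iN].
      by rewrite addr0; exact: (single_in (x n)).
    exact: (@single_out i (x i) n).
  rewrite oppr0 add0r big1 => [|i _]; first by rewrite subr0.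
  by rewrite single_out// ltn_eqF// (leq_trans (ltn_ord i)).
by rewrite {1}/synthesis (cvg_lim _ tailE).
Qed.

Section Analysis.
Variable u : forall n, F n.
Hypothesis u1 : forall n, `|u n| <= 1.

Lemma spread_coef_le (x : E) n : `| `|basis_coef e x n *: u n| | <= `|basis_coef e x n|.
Proof. by rewrite normr_id normrZ ler_piMr//; exact: u1. Qed.

Lemma spread_cvg (x : E) : cvgn (series (fun n => `|basis_coef e x n *: u n| *: e n)).
Proof.
exact: (Defs.dominated_cvg he (spread_coef_le x) (@basis_coef_cvg _ _ _ _ he x)).
Qed.

(** It serves twice: composing f with it yields the modulus, and it inverts [collapse] up to a
    scalar. *)
Definition spread (x : E) : X := DSum (@spread_cvg x).

Lemma spread_le x : `|spread x| <= `|x|.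
Proof.
rewrite -[x in leRHS](basis_coefK he).
exact: (dominated_lim he (spread_coef_le x) (@basis_coef_cvg _ _ _ _ he x)).
Qed.

Lemma spread_linear : linear (spread : E -> X).
Proof.
move=> t x y; apply: dsumP => n; rewrite dsum_coordD dsum_coordZ /=.
by rewrite (basis_coef_lin he) scalerDl scalerA.
Qed.

Lemma spread_basis n : spread (e n) = single (u n).
Proof.
apply: dsumP => m; rewrite [LHS]/= (basis_coef_basis he).
have [->|mn] := eqVneq m n; first by rewrite scale1r single_in.
by rewrite scale0r single_out// eq_sym.
Qed.

End Analysis.

Section Collapse.
Variable phi : forall n, F n -> K.
Hypothesis phi_linear : forall n, linear (phi (n := n) : F n -> K^o).
Hypothesis phi_le : forall n (y : F n), `|phi y| <= `|y|.

Definition collapse_coef (x : X) : nat -> K := fun n => phi (x n).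

Lemma collapse_coef_le (x : X) n : `|collapse_coef x n| <= `|coord_norms x n|.
Proof. by rewrite /coord_norms normr_id; exact: phi_le. Qed.

Lemma collapse_cvg (x : X) : summable_coefs e (collapse_coef x).
Proof.
exact: (Defs.dominated_cvg he (collapse_coef_le x) (@coord_norms_cvg x)).
Qed.

Definition collapse (x : X) : E := synthesis e (collapse_coef x).

Lemma collapse_le x : `|collapse x| <= `|x|.
Proof.
exact: (dominated_lim he (collapse_coef_le x) (@coord_norms_cvg x)).
Qed.

Lemma collapse_linear : linear (collapse : X -> E).
Proof.
move=> t x y; rewrite /collapse -(synthesis_lin t (@collapse_cvg x) (@collapse_cvg y)).
congr synthesis; apply/funext => n.
by rewrite /collapse_coef dsum_coordD dsum_coordZ phi_linear.
Qed.

Lemma collapse_spread (u : forall n, F n) (u1 : forall n, `|u n| <= 1) (t : K) :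
  (forall n, phi (u n) = t) -> forall x, collapse (spread u1 x) = t *: x.
Proof.
move=> ut x; have phi0 n : phi (0 : F n) = 0.
  by have := phi_linear (n := n) (-1) 0 0; rewrite scaler0 addr0 scaleN1r addNr.
have b0 n : basis_coef e 0 n = 0.
  by have := basis_coef_lin he (-1) 0 0 n; rewrite scaler0 addr0 mulN1r addNr.
(* A zero vector is added to match the shape t * a + b of [cvg_lin]. *)
apply: cvg_lim => //; rewrite -[X in _ --> X]addr0.
rewrite [X in series X](_ : _ = fun n =>
    (t * basis_coef e x n + basis_coef e 0 n) *: e n).
  exact: (@cvg_lin _ _ E e t _ _ _ _
    (@basis_coefP _ _ _ _ he x) (@basis_coefP _ _ _ _ he 0)).
apply/funext => n; congr (_ *: _); rewrite b0 addr0 /collapse_coef /=.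
have := phi_linear (n := n) (basis_coef e x n) (u n) 0.
by rewrite !addr0 phi0 addr0 ut /GRing.scale /= mulrC => ->.
Qed.

End Collapse.

End DirectSumMaps.

(** * The modulus and the upper bound *)

Section UpperBound.
Variables (R : realType) (k : scalar_kind).
Local Notation K := (scalar_field R k).
Local Notation sc := (@of_real R k).
Variables (E : completeNormedModType K) (e : nat -> E).
Hypothesis he : normalized_1unconditional_basis e.
Variable F : nat -> completeNormedModType K.
Local Notation X := (direct_sum F he).
Implicit Types f g : dual_space X.

Definition coord_restr f n : F n -> K := fun y => f (single he y).

(** This is ||f_n||, where f_n is the restriction of f to the n-th summand. *)
Definition coord_mass f n : R := functional_norm (coord_restr f (n := n)).

Lemma coord_restr_linear f n : linear (coord_restr f (n := n) : F n -> K^o).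
Proof. by move=> t y z; rewrite /coord_restr single_linear dualD dualZ. Qed.

Lemma coord_restr_le f n (y : F n) : dual_ball f -> `|coord_restr f y| <= `|y|.
Proof. by move=> /dual_ballP fb; rewrite -(single_norm he y); exact: fb. Qed.

Lemma coord_restr_bounded f n : dual_ball f -> norm_bounded (coord_restr f (n := n)).
Proof.
move=> fb; exists 1 => y y1; rewrite rmorph1; apply: le_trans y1.
exact: coord_restr_le.
Qed.

Lemma coord_mass_ge0 f n : dual_ball f -> 0 <= coord_mass f n.
Proof. by move=> fb; apply: functional_norm_ge0; exact: coord_restr_bounded. Qed.

Lemma coord_mass_bound f n (y : F n) : dual_ball f ->
  `|f (single he y)| <= sc (coord_mass f n) * `|y|.
Proof.
move=> fb; apply: (functional_norm_bound (f := coord_restr f (n := n))).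
  exact: coord_restr_linear.
exact: coord_restr_bounded.
Qed.

Lemma coord_mass_close f g n (eta : R) : dual_ball g ->
  (forall y : F n, `|y| <= 1 -> `|f (single he y) - g (single he y)| <= sc eta) ->
  coord_mass f n <= coord_mass g n + eta.
Proof.
move=> gb fg; apply: functional_norm_le => y y1.
rewrite -(subrK (g (single he y)) (coord_restr f y)) (le_trans (ler_normD _ _))//.
rewrite addrC rmorphD; apply: lerD; last exact: fg.
apply: (functional_norm_ge (f := coord_restr g (n := n))) => //.
exact: coord_restr_bounded.
Qed.

Let is_modulus f (h : dual_space E) :=
  dual_ball h /\ forall n, h (e n) = sc (coord_mass f n / 2).

(* Half of the functional sending e_n to the norm of the n-th component of f.
   The factor 1/2 lets us avoid norm attainment: it is f composed with
   x |-> (x_n u_n)_n, where u_n in the unit ball of F_n takes half the norm of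
   the n-th component. *)
Definition modulus f : dual_space E := xget (dual_zero E) (is_modulus f).

Lemma modulusP f : dual_ball f -> is_modulus f (modulus f).
Proof.
move=> fb; rewrite /modulus; case: xgetP => [h _ //|none]; exfalso.
have u_ex n : exists2 u : F n, `|u| <= 1 & coord_restr f u = sc (coord_mass f n / 2).
  by apply: functional_norm_attained_half;
    [exact: coord_restr_linear|exact: coord_restr_bounded].
pose u n := s2val (cid2 (u_ex n)).
have u1 n : `|u n| <= 1 by rewrite /u; case: cid2.
have uE n : coord_restr f (u n) = sc (coord_mass f n / 2) by rewrite /u; case: cid2.
pose h x := f (spread he u1 x).
have hl : linear (h : E -> K^o).
  by move=> t x y; rewrite /h spread_linear dualD dualZ.
have hb x : `|h x| <= `|x|.
  by apply: le_trans (spread_le he u1 x); exact: (dual_ballP _).1.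
apply: (none (bounded_dual hl hb)); split; first by apply/dual_ballP.
by move=> n; rewrite /= /h spread_basis -uE.
Qed.

Lemma modulus_sum f (fb : dual_ball f) (r : seq nat) (a : nat -> K) :
  modulus f (\sum_(i <- r) a i *: e i) =
  \sum_(i <- r) a i * sc (coord_mass f i / 2).
Proof.
rewrite dual_sum; apply: eq_bigr => i _.
by rewrite dualZ (modulusP fb).2.
Qed.

(** Termwise |f_i(x_i)| <= ||f_i|| |x_i|; the terms on the right are nonnegative, so no cancellation
    is lost, and the 2 undoes the 1/2 in the modulus. *)
Lemma modulus_tail f (x : X) (N M : nat) : dual_ball f ->
  `|\sum_(N <= i < M) f (single he (x i))| <=
  2 * `|modulus f (\sum_(N <= i < M) coord_norms x i *: e i)|.
Proof.
move=> fb; rewrite modulus_sum// [`|\sum_(_ <= _ < _) _ * _|]ger0_norm; last first.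
  apply: sumr_ge0 => i _; rewrite mulr_ge0 ?normr_ge0// of_real_ge0.
  by rewrite divr_ge0// coord_mass_ge0.
rewrite mulr_sumr (le_trans (ler_norm_sum _ _ _))//; apply: ler_sum => i _.
apply: le_trans (coord_mass_bound _ fb) _.
rewrite /coord_norms rmorphM fmorphV rmorph_nat mulrCA [2 * _]mulrC -mulrA.
by rewrite mulVf ?pnatr_eq0// mulr1 mulrC.
Qed.

Hypothesis hF : forall n, finite_dimensional (F n).

Definition close_on_head N (eta : R) f g := forall n, (n < N)%N ->
  forall y : F n, `|y| <= 1 -> `|f (single he y) - g (single he y)| <= sc eta.

(** The place where finite dimension enters the upper bound: a spanning family with bounded
    coefficients makes norm closeness of each component a weak-star condition. *)
Lemma close_on_head_weak N (eta : R) f : 0 < eta ->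
  weak_base f [set g | close_on_head N eta f g].
Proof.
move=> eta0; have WF := weak_base_filter f.
elim: N => [|N IH]; first by apply: filterS filterT.
have [m [b [C [C0 bC]]]] := finite_dimensional_bounded_coefs (hF N).
(* A combination of m vectors with coefficients at most C accumulates an error m C d <= eta; the + 1
   keeps the denominator positive. *)
pose d := eta / (m%:R * C + 1).
have mC0 : 0 < m%:R * C + 1 by rewrite ltr_wpDl// mulr_ge0.
have d0 : 0 < d by rewrite divr_gt0.
have clN : weak_base f [set g | forall y : F N, `|y| <= 1 ->
    `|f (single he y) - g (single he y)| <= sc eta].
  exists [seq single he (b i) | i <- iota 0 m], (sc d); rewrite of_real_gt0; split => //.
  move=> g fg y y1; have [c yE cb] := bC y y1.
  have singleE (h : dual_space X) :
      h (single he y) = \sum_(i < m) c i * h (single he (b i)).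
    transitivity (coord_restr h y) => //; rewrite yE.
    elim/big_rec2: _ => [|i z w _ <-].
      have := coord_restr_linear h (-1) (0 : F N) 0.
      by rewrite scaler0 addr0 scaleN1r addNr.
    exact: coord_restr_linear.
  rewrite !singleE -sumrB (le_trans (ler_norm_sum _ _ _))//.
  apply: (@le_trans _ _ (\sum_(i < m) sc C * sc d)).
    apply: ler_sum => i _; rewrite -mulrBr normrM; apply: ler_pM => //; first exact: cb.
    apply/ltW/fg; apply/mapP; exists (i : nat) => //.
    by rewrite mem_iota /= add0n ltn_ord.
  rewrite sumr_const card_ord -[leLHS]mulr_natl -(rmorph_nat sc m) -!rmorphM ler_of_real.
  rewrite (_ : m%:R * _ = eta * (m%:R * C / (m%:R * C + 1))); last by rewrite /d; ring.
  by apply: ler_piMr; [exact: ltW|rewrite ler_pdivrMr// mul1r lerDl].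
apply: filterS2 IH clN => g gN gSN n.
by rewrite ltnS leq_eqVlt => /predU1P[->//|]; exact: gN.
Qed.

(** A partial sum S of x involves only finitely many of the norms ||f_i||, which are controlled on
    the head; on x - S it suffices that all moduli lie in the ball. *)
Lemma modulus_weak_continuous f (t : seq E) (d : K) : dual_ball f -> 0 < d ->
  weak_base f [set g | dual_ball g -> weak_close t d (modulus f) (modulus g)].
Proof.
move=> fb d0; have WF := weak_base_filter f.
elim: t => [|x t IH]; first by apply: filterS filterT.
suff cx : weak_base f [set g | dual_ball g -> `|modulus f x - modulus g x| < d].
  apply: filterS2 cx IH => g gx gt gb y.
  by rewrite inE => /predU1P[->|yt]; [exact: gx|exact: gt].
have d4 : 0 < d / 4 by rewrite divr_gt0.
have [N _ /(_ N (leqnn N)) xN] := basis_partial_cvg he x d4.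
pose r := real_part d; have dE : d = sc r by rewrite of_realK// ltW.
have r0 : 0 < r by rewrite -(of_real_gt0 k) -dE.
pose B := real_part `|x|; have BE : `|x| = sc B by rewrite of_realK.
have B0 : 0 <= B by rewrite -(of_real_ge0 k) -BE.
(* N coefficients of size at most B, times changes of at most eta / 2 in the halved norms, add up to
   at most r / 4. *)
pose eta := r / (2 * (N%:R * B + 1)).
have NB0 : 0 < 2 * (N%:R * B + 1) by rewrite mulr_gt0// ltr_wpDl// mulr_ge0.
have eta0 : 0 < eta by rewrite divr_gt0.
apply: filterS (close_on_head_weak N f eta0) => g fg gb.
set S := \sum_(i < N) _ in xN.
have -> : modulus f x - modulus g x = (modulus f S - modulus g S) +
    (modulus f (x - S) - modulus g (x - S)) by rewrite !dualB; ring.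
have headS : `|modulus f S - modulus g S| <= d / 4.
  rewrite /S -(big_mkord xpredT (fun i => basis_coef e x i *: e i)) !modulus_sum// -sumrB.
  rewrite (le_trans (ler_norm_sum _ _ _))// big_mkord.
  apply: (@le_trans _ _ (\sum_(i < N) sc B * sc (eta / 2))).
    apply: ler_sum => i _; rewrite -mulrBr normrM; apply: ler_pM => //.
      by rewrite -BE; exact: basis_coef_le.
    have fgi := fg i (ltn_ord i).
    have h1 := coord_mass_close gb fgi.
    have h2 : coord_mass g i <= coord_mass f i + eta.
      by apply: (coord_mass_close fb) => y y1; rewrite distrC; exact: fgi.
    have nR (z : R) : `|sc z| = sc `|z|.
      have [z0|z0] := leP 0 z; first by rewrite norm_of_real ?ger0_norm.
      by rewrite -normrN -rmorphN norm_of_real ?ltr0_norm// oppr_ge0 ltW.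
    by rewrite -rmorphB nR ler_of_real ler_norml; lra.
  rewrite sumr_const card_ord -[leLHS]mulr_natl -(rmorph_nat sc N) -!rmorphM dE.
  have -> : sc r / 4 = sc (r / 4) by rewrite rmorphM fmorphV rmorph_nat.
  rewrite ler_of_real /eta.
  have -> : N%:R * (B * (r / (2 * (N%:R * B + 1)) / 2)) =
    (r / 4) * (N%:R * B / (N%:R * B + 1)).
    have : N%:R * B + 1 != 0 by rewrite gt_eqF// ltr_wpDl// mulr_ge0.
    by move=> ?; field.
  have NB1 : 0 < N%:R * B + 1 by rewrite ltr_wpDl// mulr_ge0.
  apply: ler_piMr; first by rewrite divr_ge0// ltW.
  by rewrite ler_pdivrMr// mul1r lerDl.
have tail (h : dual_space X) : dual_ball h -> `|modulus h (x - S)| < d / 4.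
  by move=> hb; apply: le_lt_trans xN; exact: (dual_ballP _).1 (modulusP hb).1 _.
rewrite (le_lt_trans (ler_normD _ _))//.
have -> : d = d / 4 + (d / 4 + d / 4) + d / 4 by field.
rewrite -[ltLHS]addr0; apply: ltrD => //; apply: ler_ltD => //.
by rewrite (le_lt_trans (ler_normB _ _))//; apply: ltrD; exact: tail.
Qed.

(** The tail of g is not assumed small: its modulus is within d of that of f, hence at most 2 d
    there, which gives 4 d after doubling. The + 1 in N.+1 covers an empty head. *)
Lemma modulus_estimate f g (x : X) (N : nat) (d : R) : dual_ball f -> dual_ball g ->
  0 < d ->
  (forall M (a : nat -> K), `|\sum_(N <= i < M) a i *: e i| <= 1 ->
    `|modulus f (\sum_(N <= i < M) a i *: e i)| <= sc d) ->
  (forall y, `|y| <= 1 -> `|modulus f y - modulus g y| <= sc d) ->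
  close_on_head N (d / N.+1%:R) f g -> `|x| <= 1 -> `|f x - g x| <= sc (8 * d).
Proof.
move=> fb gb d0 ftail fgd fghead x1.
have d2 : 0 < sc (d / 2) by rewrite of_real_gt0 divr_gt0.
have [M0 _ HM] := dsum_partial_cvg x d2.
have {HM M0}[M NM xM] : exists2 M, (N <= M)%N &
    `|x - \sum_(i < M) single he (x i)| < sc (d / 2).
  by exists (maxn N M0); [exact: leq_maxl|apply: HM; exact: leq_maxr].
set S := \sum_(i < M) _ in xM.
set z := \sum_(N <= i < M) coord_norms x i *: e i.
have z1 : `|z| <= 1 by apply: le_trans x1; exact: coord_norms_partial_le.
have hsum (h : dual_space X) : h S = \sum_(0 <= i < N) h (single he (x i)) +
    \sum_(N <= i < M) h (single he (x i)).
  by rewrite -big_cat_nat//= big_mkord dual_sum.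
have ft : `|\sum_(N <= i < M) f (single he (x i))| <= sc (2 * d).
  apply: le_trans (modulus_tail x N M fb) _; rewrite rmorphM rmorph_nat.
  by rewrite ler_wpM2l//; exact: ftail.
have gt : `|\sum_(N <= i < M) g (single he (x i))| <= sc (4 * d).
  apply: le_trans (modulus_tail x N M gb) _.
  rewrite (_ : 4 * d = 2 * (d + d)); last by ring.
  rewrite rmorphM rmorph_nat rmorphD ler_wpM2l// -/z.
  rewrite -(subrK (modulus f z) (modulus g z)) (le_trans (ler_normD _ _))//.
  by apply: lerD; [rewrite distrC; exact: fgd|exact: ftail].
have hd : `|\sum_(0 <= i < N) f (single he (x i)) - \sum_(0 <= i < N) g (single he (x i))|
    <= sc d.
  rewrite -sumrB (le_trans (ler_norm_sum _ _ _))// big_mkord.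
  apply: (@le_trans _ _ (\sum_(i < N) sc (d / N.+1%:R))).
    apply: ler_sum => i _; apply: fghead => //.
    by apply: le_trans x1; exact: dsum_coord_le.
  rewrite sumr_const card_ord -[leLHS]mulr_natl -(rmorph_nat sc N) -rmorphM ler_of_real.
  rewrite mulrCA; apply: ler_piMr; first exact: ltW.
  by rewrite ler_pdivrMr// mul1r ler_nat.
have xS (h : dual_space X) : dual_ball h -> `|h (x - S)| <= sc (d / 2).
  by move=> hb; apply: le_trans (ltW xM); exact: (dual_ballP _).1 hb _.
have -> : f x - g x = ((\sum_(0 <= i < N) f (single he (x i)) -
    \sum_(0 <= i < N) g (single he (x i))) + (\sum_(N <= i < M) f (single he (x i)) -
    \sum_(N <= i < M) g (single he (x i)))) + (f (x - S) - g (x - S)).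
  by rewrite !dualB !hsum; ring.
rewrite (_ : 8 * d = (d + (2 * d + 4 * d)) + (d / 2 + d / 2)); last by field.
rewrite !rmorphD (le_trans (ler_normD _ _))//; apply: lerD; last first.
  by rewrite (le_trans (ler_normB _ _))//; apply: lerD; exact: xS.
rewrite (le_trans (ler_normD _ _))//; apply: lerD => //.
by rewrite (le_trans (ler_normB _ _))//; apply: lerD.
Qed.

Hypothesis fE : finite_szlenk E.

(** By contradiction: a neighbourhood of modulus f in B of diameter at most d pulls back to a
    neighbourhood of f in A all of whose points lie within 8 d of f. *)
Lemma modulus_derivation (d : R) (A : set (dual_space X)) (B : set (dual_space E)) f :
  0 < d -> A `<=` @dual_ball _ _ X -> (forall g, A g -> B (modulus g)) ->
  szlenk_derivation (16 * d) A f -> szlenk_derivation d B (modulus f).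
Proof.
move=> d0 Ab AB /szlenk_derivationP[Af H]; have fb := Ab f Af.
apply/szlenk_derivationP; split; first exact: AB.
move=> t dt dt0; apply: contrapT => none.
have [N ftail] := finite_szlenk_shrinking he fE (modulusP fb).1 d0.
have dN0 : 0 < d / N.+1%:R by rewrite divr_gt0.
have WF := weak_base_filter f.
have [s [ds [ds0 sP]]] := filterI (modulus_weak_continuous t fb dt0)
  (close_on_head_weak N f dN0).
have [g [h [x [Ag Ah [fg fh x1 gh]]]]] := H s ds ds0.
(* The pair tested against [none] is modulus f, modulus g': a unit vector separating them by more
   than d would be a forbidden witness. *)
have near g' : A g' -> weak_close s ds f g' -> `|f x - g' x| <= sc (8 * d).
  move=> Ag' /sP[/(_ (Ab _ Ag')) fg' head].
  apply: (modulus_estimate fb (Ab _ Ag') d0 ftail) => // y y1.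
  rewrite nneg_leNgt//; apply/negP => dy; apply: none.
  exists (modulus f), (modulus g'), y; split; [exact: AB..|split => //].
  by move=> z _; rewrite subrr normr0.
move: gh; rewrite nneg_ltNge// => /negP; apply.
have -> : g x - h x = (f x - h x) - (f x - g x) by ring.
rewrite (_ : 16 * d = 8 * d + 8 * d); last by ring.
by rewrite rmorphD (le_trans (ler_normB _ _))//; apply: lerD; exact: near.
Qed.

Lemma modulus_iter (d : R) n f : 0 < d ->
  szlenk_iter (16 * d) (ord_nat n) (@dual_ball _ _ X) f ->
  szlenk_iter d (ord_nat n) (@dual_ball _ _ E) (modulus f).
Proof.
move=> d0; elim: n f => [|n IH] f /=; first by move=> fb; exact: (modulusP fb).1.
by apply: modulus_derivation => //; exact: szlenk_iter_sub.
Qed.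

Lemma direct_sum_finite_szlenk : finite_szlenk X.
Proof.
move=> eps eps0; have e16 : 0 < eps / 16 by rewrite divr_gt0.
have [n n0] := fE e16; exists n; rewrite -subset0 => f.
rewrite (_ : eps = 16 * (eps / 16)); last by field.
by move=> /(modulus_iter e16); rewrite n0.
Qed.

Lemma szlenk_nat_direct_sum_le (d : R) : 0 < d ->
  (szlenk_nat X (16 * d) <= szlenk_nat E d)%N.
Proof.
move=> d0; apply: szlenk_nat_le; rewrite -subset0 => f /(modulus_iter d0).
by have [-> _] := szlenk_natP fE d0.
Qed.

End UpperBound.

(** * Adjoints and the lower bound *)

Section LowerBound.
Variables (R : realType) (k : scalar_kind).
Local Notation K := (scalar_field R k).
Local Notation sc := (@of_real R k).
Variables (E : completeNormedModType K) (e : nat -> E).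
Hypothesis he : normalized_1unconditional_basis e.
Variable F : nat -> completeNormedModType K.
Local Notation X := (direct_sum F he).

Section Adjoint.
Variables (V W : normedModType K) (P : W -> V).
Hypotheses (Pl : linear P) (Ple : forall x, `|P x| <= `|x|).

Lemma adjoint_linear (f : dual_space V) : linear ((fun x => f (P x)) : W -> K^o).
Proof. by move=> t x y; rewrite Pl dualD dualZ. Qed.

Lemma adjoint_continuous (f : dual_space V) : continuous (fun x => f (P x)).
Proof.
move=> x; apply: (@continuous_comp W V K P f).
  exact: bounded_linear_continuous.
exact: dual_continuous.
Qed.

Definition adjoint (f : dual_space V) : dual_space W :=
  DualSpace (adjoint_linear f) (@adjoint_continuous f).

Lemma adjoint_ball f : dual_ball f -> dual_ball (adjoint f).
Proof.
by move=> /dual_ballP fb; apply/dual_ballP => x; exact: le_trans (fb _) (Ple x).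
Qed.

(** A vector x separating g from h is replaced by J x, on which their adjoints differ by c times as
    much. *)
Lemma adjoint_iter (J : V -> W) (c eps : R) n f : 0 < c ->
  (forall x, `|J x| <= `|x|) -> (forall x, P (J x) = sc c *: x) ->
  szlenk_iter eps (ord_nat n) (@dual_ball _ _ V) f ->
  szlenk_iter (c * eps) (ord_nat n) (@dual_ball _ _ W) (adjoint f).
Proof.
move=> c0 Jle PJ; apply: szlenk_iter_transport; first exact: adjoint_ball.
  move=> t d d0; exists [seq P x | x <- t], d; split => // g h _ _ gh x xt.
  by apply: gh; apply: map_f.
move=> g h x _ _ x1 gh; exists (J x); first exact: le_trans (Jle x) x1.
rewrite /= PJ !dualZ -mulrBr normrM norm_of_real ?ltW// rmorphM.
by rewrite ltr_pM2l// of_real_gt0.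
Qed.

End Adjoint.

Hypothesis hF : forall n, finite_dimensional (F n).
Hypothesis hF0 : forall n, exists x : F n, x != 0.
Hypothesis fX : finite_szlenk X.

Lemma szlenk_nat_direct_sum_ge (d : R) : 0 < d ->
  (szlenk_nat E d <= szlenk_nat X (2^-1 * d))%N.
Proof.
move=> d0; have phi_ex n := cid2 (finite_dimensional_functional (hF n) (hF0 n)).
pose phi n := s2val (phi_ex n).
have phil n : linear (phi n : F n -> K^o) by exact: (s2valP (phi_ex n)).1.
have phile n (y : F n) : `|phi n y| <= `|y| by exact: (s2valP (phi_ex n)).2.
pose u n := s2val (cid2 (s2valP' (phi_ex n))).
have u1 n : `|u n| <= 1 by exact: (s2valP (cid2 (s2valP' (phi_ex n)))).
have ut n : phi n (u n) = sc 2^-1.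
  rewrite fmorphV rmorph_nat; exact: (s2valP' (cid2 (s2valP' (phi_ex n)))).
apply: szlenk_nat_le; rewrite -subset0 => f fn.
have d2 : 0 < 2^-1 * d by rewrite mulr_gt0// invr_gt0.
have [X0 _] := szlenk_natP fX d2.
have Pl : linear (collapse phi : X -> E) by exact: collapse_linear.
have Ple (x : X) : `|collapse phi x| <= `|x| by exact: collapse_le.
suff : (set0 : set (dual_space X)) (adjoint Pl Ple f) by [].
rewrite -X0.
apply: (@adjoint_iter _ _ _ Pl Ple (spread he u1)) fn; first by rewrite invr_gt0.
  exact: spread_le.
exact: collapse_spread.
Qed.

End LowerBound.

(** * Bounded perturbations of the logarithm, and the conclusion *)

Lemma power_type_perturb (R : realType) (L L' : R -> R) (C p : R) :
  (forall e, 0 < e -> `|L' e - L e| <= C) ->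
  L e / `|ln e| @[e --> 0^'+] --> p -> L' e / `|ln e| @[e --> 0^'+] --> p.
Proof.
move=> LC /cvgrPdist_le Lp; apply/cvgrPdist_le => eta eta0.
have eta2 : 0 < eta / 2 by rewrite divr_gt0.
have C0 : 0 <= C by apply: le_trans (LC 1 ltr01).
(* Once |ln x| exceeds M, the error C / |ln x| is at most eta / 2. *)
pose M := C / (eta / 2) + 1.
have M0 : 0 < M by rewrite ltr_wpDl// divr_ge0// ltW.
near=> x.
have x0 : 0 < x by near: x; exact: nbhs_right_gt.
have xM : x < expR (- M) by near: x; apply: nbhs_right_lt; exact: expR_gt0.
have x1 : 0 < x < 1 by rewrite x0 (lt_trans xM)// -expR0 ltr_expR oppr_lt0.
have lnx : M < `|ln x|.
  by rewrite ltr0_norm ?ln_lt0// ltrNr -(expRK (- M)) ltr_ln ?posrE ?expR_gt0.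
have Lx : `|p - L x / `|ln x| | <= eta / 2 by near: x; exact: Lp.
have lnx0 : 0 < `|ln x| by exact: lt_trans lnx.
have -> : p - L' x / `|ln x| = (p - L x / `|ln x|) - (L' x - L x) / `|ln x| by ring.
rewrite (le_trans (ler_normB _ _))// [leRHS]splitr; apply: lerD => //.
rewrite normrM normfV (gtr0_norm lnx0) ler_pdivrMr//; apply: (le_trans (LC x x0)).
rewrite mulrC -ler_pdivrMr//; apply: le_trans (ltW lnx).
by rewrite lerDl.
Unshelve. all: by end_near. Qed.

Section LogSzlenk.
Variables (R : realType) (k : scalar_kind).
Variable X : normedModType (scalar_field R k).
Hypothesis fX : finite_szlenk X.

Definition log_szlenk (d : R) : R := ln (szlenk_nat X d)%:R.

Lemma log_szlenk_ge0 d : 0 < d -> 0 <= log_szlenk d.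
Proof. by move=> d0; rewrite ln_ge0// ler1n; exact: szlenk_nat_gt0. Qed.

Lemma log_szlenk_mono d d' : 0 < d -> d <= d' -> log_szlenk d' <= log_szlenk d.
Proof.
move=> d0 dd; rewrite ler_ln ?posrE ?ltr0n ?szlenk_nat_gt0//.
  by rewrite ler_nat; exact: szlenk_nat_mono.
exact: lt_le_trans dd.
Qed.

Lemma log_szlenk_submul d d' : 0 < d -> 0 < d' ->
  log_szlenk (d * d') <= log_szlenk d + log_szlenk d'.
Proof.
move=> d0 d'0; rewrite addrC -lnM ?posrE ?ltr0n ?szlenk_nat_gt0// -natrM.
rewrite ler_ln ?posrE ?ltr0n ?muln_gt0 ?szlenk_nat_gt0 ?mulr_gt0// ler_nat.
exact: szlenk_nat_submul.
Qed.

End LogSzlenk.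

Theorem theorem15 (R : realType) (k : scalar_kind)
    (E : completeNormedModType (scalar_field R k)) (e : nat -> E)
    (he : normalized_1unconditional_basis e)
    (hSz : is_szlenk E ord_omega)
    (F : nat -> completeNormedModType (scalar_field R k))
    (hF : forall n, finite_dimensional (F n))
    (hF0 : forall n, exists x : F n, x != 0) :
  exists2 p : R,
    is_szlenk_power_type E p & is_szlenk_power_type (direct_sum F he) p.
Proof.
have fE := szlenk_omega_finite hSz.
have fX : finite_szlenk (direct_sum F he) := direct_sum_finite_szlenk he hF fE.
pose LE := @log_szlenk R k E; pose LX := @log_szlenk R k (direct_sum F he).
have [p Ep] := subadditive_power_type (log_szlenk_ge0 fE) (log_szlenk_mono fE)
  (log_szlenk_submul fE).
exists p; first by split => //; exact: finite_is_szlenk.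
split; first exact: finite_is_szlenk.
have h2 : 0 < 2^-1 :> R by rewrite invr_gt0.
have h16 : 0 < 16^-1 :> R by rewrite invr_gt0.
(* The constants 2 and 16 are absorbed by submultiplicativity in E alone; the limit for the direct
   sum then exists because the one for E does. Both summands of C are nonnegative, so their sum
   serves both inequalities. *)
apply: (power_type_perturb (L := LE) (C := LE 2^-1 + LE 16^-1)) Ep => d d0.
have LE2 : 0 <= LE 2^-1 by exact: log_szlenk_ge0.
have LE16 : 0 <= LE 16^-1 by exact: log_szlenk_ge0.
have upper : LX d <= LE d + LE 16^-1.
  apply: le_trans (log_szlenk_submul fE d0 h16).
  have d16 : 0 < d * 16^-1 by rewrite mulr_gt0.
  rewrite ler_ln ?posrE ?ltr0n ?szlenk_nat_gt0// ler_nat.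
  have := szlenk_nat_direct_sum_le he hF fE d16.
  by rewrite (_ : 16 * (d * 16^-1) = d)//; field.
have lower : LE d <= LX d + LE 2^-1.
  have d2 : 0 < 2 * d by rewrite mulr_gt0.
  have -> : LE d = LE (2 * d * 2^-1) by congr LE; field.
  apply: le_trans (log_szlenk_submul fE d2 h2) _; rewrite lerD2r.
  rewrite ler_ln ?posrE ?ltr0n ?szlenk_nat_gt0// ler_nat.
  have := szlenk_nat_direct_sum_ge hF hF0 fX d2.
  by rewrite mulKf.
rewrite -[ln _]/(LX d) ler_norml.
move: (LX d) (LE d) (LE 2^-1) (LE 16^-1) upper lower LE2 LE16 => *.
by apply/andP; split; lra.
Qed.
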